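(* For every constant $c \ge 2$ there is a constant $C>0$ such that for every $n$-vertex graph $G$ (with $n\ge 2$), the parallel randomized greedy MIS algorithm run on $G$ terminates within $C\log n$ rounds with probability at least $1-n^{-c}$.
   Context: Let $G=(V,E)$ be a graph with $n$ vertices. The parallel randomized greedy MIS algorithm works as follows. An order of the vertices, i.e. a bijection $\pi\colon[n]\to V$ (where $[n]=\{1,\dots,n\}$ and $\pi(i)$ is the vertex at position $i$), is chosen uniformly at random and kept fixed throughout. Then, in each round, every remaining vertex whose position is smaller than the positions of all its remaining neighbors (a local minimum) is added to the independent set, and all these vertices together with all their neighbors are removed from the graph. The number of rounds is the number of rounds until no vertex remains. *)

(* Defs.v *)
From Stdlib Require Import Reals.
From mathcomp Require Import all_boot all_fingroup.
Set Implicit Arguments. Unset Strict Implicit. Unset Printing Implicit Defensive.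

(* Graphs: simple graphs on vertex set 'I_n given by a symmetric irreflexive
   edge relation e.  An order is a bijection pi : [n] -> V, represented as a
   permutation pi : {perm 'I_n}; pi i is the vertex at (0-indexed) position i,
   so the position of vertex v is (pi^-1) v. *)

Section Greedy.
Variables (n : nat) (e : rel 'I_n) (pi : {perm 'I_n}).

Definition pos (v : 'I_n) : nat := nat_of_ord ((pi^-1)%g v).

Definition local_minima (S : {set 'I_n}) : {set 'I_n} :=
  [set v in S | [forall u in S, e v u ==> (pos v < pos u)%N]].

Definition greedy_step (S : {set 'I_n}) : {set 'I_n} :=
  let L := local_minima S in
  [set v in S | (v \notin L) && ~~ [exists u in L, e u v]].

Definition remaining (k : nat) : {set 'I_n} := iter k greedy_step setT.

(* number of rounds until no vertex remains: least k (<= n; it always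
   terminates within n rounds) with remaining k = set0 *)
Definition num_rounds : nat :=
  find (fun k => remaining k == set0) (iota 0 n.+1).
End Greedy.

Definition Rleb (x y : R) : bool := if Rle_dec x y then true else false.

Definition prob_within (n : nat) (e : rel 'I_n) (t : R) : R :=
  Rdiv (INR #|[set pi : {perm 'I_n} | Rleb (INR (num_rounds e pi)) t]|)
       (INR #|{perm 'I_n}|).

(* Main.v *)
(** A run of more than [L] rounds contains a dependency path
    [m_0, u_0, m_1, ..., u_{L-1}, m_L] of increasing positions: the [m_i] belong to
    the greedy MIS, [u_i] is adjacent to [m_{i+1}], and [m_i] is the earliest MIS
    neighbour of [u_i].  Replace the random order by independent uniform labels
    below a huge [N] and cut the label range into O(log n) cells, on each of which
    a label grows by a factor at most [1 + 1/R].  Let [D_i] be the set of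
    neighbours of [m_{i+1}] that are still undecided at the start of the cell of
    [m_i]; the [D_i] of different cells are almost disjoint, and the load of a path
    is the sum over the cells of (start of the cell) * |union of its [D_i]|.

    Paths of load larger than [C L N] are rare by an encoding argument.  Give
    [u_i] and [m_{i+1}] new labels below that of [m_i], obtained by rescaling, and
    [L] vertices of the [D_i] new labels shortly before the start of their cell.
    The new labelling determines everything that was moved up to C^L n^{O(1)}
    possibilities: restoring the labels in increasing order, the next moved vertex
    is always the first MIS vertex that kills a vertex known to survive.  There are
    about (load / (L N))^L choices for the new labels, which outweighs the loss.

    Paths of load at most [C L N] are rare by a first moment argument.  As [u_i] is
    undecided until [m_i] joins, its label can be resampled freely above that of
    [m_i], and it falls below that of [m_{i+1}] with probability about
    (gap between [m_i] and [m_{i+1}]) / N.  Walking the path backwards there are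
    |D_i| choices for [u_i], after which [m_i] is determined.  By the AM-GM
    inequality the product of |D_i| * gap / N is at most (C' / R)^L n^{O(1)}, so a
    large constant [R] suffices. *)

Require Import Defs.
From Stdlib Require Import Reals.
From Stdlib Require Lra.
From mathcomp Require Import all_boot all_fingroup all_order all_algebra.
From mathcomp Require Import zify ring lra.
Set Implicit Arguments. Unset Strict Implicit. Unset Printing Implicit Defensive.
Import Order.TTheory GRing.Theory Num.Theory.

(** * Greedy maximal independent sets and dependency paths *)

Section GreedyMis.
Variables (T : finType) (e : rel T).
Hypotheses (esym : symmetric e) (eirr : irreflexive e).
Implicit Types (p q : T -> nat) (M K : {set T}).

(** The fixed-point equation of the sequential greedy MIS. It has exactly one solution
    ([greedy_uniq], [mis_greedy]), so a set is recognised as [mis p] without following the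
    recursion. *)
Definition greedy p M :=
  forall v, (v \in M) = [forall u in M, e u v ==> (p v <= p u)].

Lemma greedy_uniq p M M' : greedy p M -> greedy p M' -> M = M'.
Proof.
move=> gM gM'; apply/setP => v.
have [k] := ubnP (p v); elim: k v => // k IH v lev.
rewrite gM gM'; apply: eq_forallb => u.
have [euv|//] := boolP (e u v); rewrite ?implybF ?implybT //=.
have [le|lt] := leqP (p v) (p u); rewrite ?implybT // IH //.
exact: leq_trans lt _.
Qed.

(** Exhausted fuel answers [false], but any fuel above [p v] gives the true value
    ([in_mis_stable]). *)
Fixpoint in_mis p k v :=
  if k is k'.+1 then [forall u, (e u v && (p u < p v)) ==> ~~ in_mis p k' u]
  else false.

Definition mis p := [set v | in_mis p (p v).+1 v].

Lemma in_mis_stable p k v : p v < k -> in_mis p k v = (v \in mis p).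
Proof.
suff gen j : p v < j -> p v < k -> in_mis p k v = in_mis p j v by rewrite inE; exact: gen.
elim: k j v => [|k IH] [|j] v // ltj ltk /=.
apply: eq_forallb => u; case: (boolP (e u v && _)) => [/andP[_ ltu]|] //=.
by congr (~~ _); apply: IH; lia.
Qed.

Lemma mis_greedy p : greedy p (mis p).
Proof.
move=> v; rewrite inE /=; apply/forallP/forallP => H u.
  apply/implyP => uM; apply/implyP => euv; rewrite leqNgt; apply/negP => lt.
  by have := H u; rewrite euv lt /= in_mis_stable // uM.
apply/implyP => /andP[euv lt]; rewrite in_mis_stable //; apply/negP => uM.
by have := H u; rewrite uM euv /= leqNgt lt.
Qed.

Lemma mis_unique p M : greedy p M -> mis p = M.
Proof. exact: greedy_uniq (mis_greedy p). Qed.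

Lemma mis_le p u v : u \in mis p -> v \in mis p -> e u v -> p v <= p u.
Proof. by move=> uM; rewrite mis_greedy => /forall_inP/(_ u uM)/implyP; apply. Qed.

Lemma mis_indep p u v : injective p -> u \in mis p -> v \in mis p -> e u v = false.
Proof.
move=> pI uM vM; apply/negbTE/negP => euv.
have /pI E : p u = p v.
  by apply/eqP; rewrite eqn_leq (mis_le uM vM euv) (mis_le vM uM) // esym.
by move: euv; rewrite E eirr.
Qed.

Lemma mis_dom p v : v \notin mis p -> exists2 u, u \in mis p & e u v && (p u < p v).
Proof.
rewrite mis_greedy negb_forall_in => /exists_inP[u uM].
by rewrite negb_imply -ltnNge => H; exists u.
Qed.

Lemma mis_iso p q : (forall u v, (p u < p v) = (q u < q v)) -> mis p = mis q.
Proof.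
move=> E; apply: mis_unique => v; rewrite mis_greedy; apply: eq_forallb => u.
by rewrite [p _ <= _]leqNgt E -leqNgt.
Qed.

(** With [K] a set of vertices known to survive, this is the next vertex to restore in [decode]. The
    default [d] stands for the absence of MIS vertices adjacent to [K]. *)
Definition first_killer d p K :=
  odflt d [pick z | [&& z \in mis p, [exists k in K, e z k] &
    [forall w in mis p, [exists k in K, e w k] ==> (p z <= p w)]]].

Lemma first_killer_eq d p K v k : injective p -> v \in mis p -> k \in K -> e v k ->
  (forall w k', w \in mis p -> k' \in K -> e w k' -> p v <= p w) ->
  first_killer d p K = v.
Proof.
move=> pI vM kK evk mv; rewrite /first_killer; case: pickP => [z|/(_ v)] /=.
  case/and3P => zM /exists_inP[k' k'K ezk'] /forall_inP/(_ v vM)/implyP H.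
  apply: pI; apply/eqP; rewrite eqn_leq (mv z k') // andbT.
  by apply: H; apply/exists_inP; exists k.
rewrite vM (_ : [exists k0 in K, e v k0]); last by apply/exists_inP; exists k.
case/negP => /=; apply/forall_inP => w wM; apply/implyP => /exists_inP[k' k'K ewk'].
exact: mv wM k'K ewk'.
Qed.

Lemma first_killerP d p K w k : w \in mis p -> k \in K -> e w k ->
  let z := first_killer d p K in
  [/\ z \in mis p, exists2 k', k' \in K & e z k' &
   forall w' k', w' \in mis p -> k' \in K -> e w' k' -> p z <= p w'].
Proof.
move=> wM kK ewk /=; rewrite /first_killer; case: pickP => [z|H] /=.
  case/and3P => zM /exists_inP ? /forall_inP mz; split=> // w' k' w'M k'K ew'k'.
  by apply: (implyP (mz w' w'M)); apply/exists_inP; exists k'.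
pose P z := (z \in mis p) && [exists k in K, e z k].
have Pw : P w by rewrite /P wM; apply/exists_inP; exists k.
case: (arg_minnP p Pw) => z /andP[zM zK] mz; case/negP: (H z).
rewrite zM zK; apply/forall_inP => w' w'M; apply/implyP => Pw'.
by apply: mz; rewrite /P w'M.
Qed.

Lemma first_killer_iso d p q K : (forall u v, (p u < p v) = (q u < q v)) ->
  first_killer d p K = first_killer d q K.
Proof.
move=> E; rewrite /first_killer (mis_iso E); congr odflt; apply: eq_pick => z /=.
congr [&& _, _ & _]; apply: eq_forallb => w.
by rewrite [p _ <= _]leqNgt E -leqNgt.
Qed.

Definition killer p u := first_killer u p [set u].

Lemma killerP p u : u \notin mis p ->
  [/\ killer p u \in mis p, e (killer p u) u, p (killer p u) < p u &
   forall w, w \in mis p -> e w u -> p (killer p u) <= p w].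
Proof.
move=> uM; have [w wM /andP[ewu lt]] := mis_dom uM.
have [zM [k' /set1P-> ek] mz] := first_killerP u wM (set11 u) ewu.
have mz' w' : w' \in mis p -> e w' u -> p (killer p u) <= p w'.
  by move=> w'M ew'; apply: (mz w' u); rewrite ?set11.
by split=> //; apply: leq_ltn_trans (mz' w wM ewu) lt.
Qed.

(* A dependency path is stored from its last vertex [z] backwards; only the
   vertices outside the MIS are listed, the MIS vertices between them being
   their killers. *)
Fixpoint chain p z us :=
  (z \in mis p) && (if us is u :: us' then
    [&& e u z, p (killer p u) < p u, p u < p z & chain p (killer p u) us'] else true).

Lemma chain_iso p q z us : (forall u v, (p u < p v) = (q u < q v)) ->
  chain p z us = chain q z us.
Proof.
move=> E; have EM := mis_iso E.
have EK u : killer p u = killer q u by exact: first_killer_iso.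
by elim: us z => [|u us IH] z /=; rewrite EM // EK !E IH.
Qed.

End GreedyMis.

(** * Rounds of the parallel algorithm and dependency paths *)

Section Rounds.
Variables (n : nat) (e : rel 'I_n) (pi : {perm 'I_n}).
Hypotheses (esym : symmetric e) (eirr : irreflexive e).
Local Notation p := (Defs.pos pi).
Local Notation S := (remaining e pi).
Local Notation M := (mis e p).

Lemma pos_inj : injective p.
Proof. by move=> u v /val_inj/perm_inj. Qed.

Lemma remainingS k : S k.+1 = greedy_step e pi (S k).
Proof. by []. Qed.

Lemma remaining_step k v : (v \in S k.+1) = [&& v \in S k, v \notin local_minima e pi (S k) &
  ~~ [exists u in local_minima e pi (S k), e u v]].
Proof. by rewrite remainingS inE. Qed.

Definition clean k := forall m u, m \in M -> m \notin S k -> e u m -> u \notin S k.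

(** A local minimum outside the MIS would have an earlier MIS neighbour; by [clean] that neighbour
    has not been removed yet, against local minimality. *)
Lemma local_minima_mis k : clean k -> local_minima e pi (S k) \subset M.
Proof.
move=> cl; apply/subsetP => v; rewrite inE => /andP[vS /forall_inP lm].
apply/negPn/negP => /(mis_dom)[m mM /andP[emv lt]].
case: (boolP (m \in S k)) => [mS|mS].
  by move: (implyP (lm m mS)); rewrite esym emv => /(_ isT); rewrite ltnNge ltnW.
by have := cl m v mM mS; rewrite esym emv vS => /(_ isT).
Qed.

(** An MIS vertex can only leave as a local minimum, since the other removed vertices have an MIS
    neighbour; and a local minimum takes its neighbours with it. *)
Lemma remaining_clean k : clean k.
Proof.
elim: k => [|k IH] m u mM; first by rewrite inE.
have lmM := subsetP (local_minima_mis IH).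
rewrite !remaining_step => mS' eum.
have [mS|mS] := boolP (m \in S k); last by rewrite negb_and (IH m u mM mS eum).
move: mS'; rewrite mS /= negb_and !negbK => /orP[mL|].
  rewrite !negb_and !negbK; apply/orP; right; apply/orP; right.
  by apply/exists_inP; exists m => //; rewrite esym.
case/exists_inP => w wL ewm.
by have := mis_indep esym eirr pos_inj (lmM w wL) mM; rewrite ewm.
Qed.

(** An MIS vertex that survives a round was blocked by an earlier remaining [u] outside the MIS. The
    killer of [u] remains as well, since otherwise [clean] would have removed [u]. Each survived
    round thus prolongs the path by one step. *)
Lemma remaining_chain k z : z \in M -> z \in S k ->
  exists2 us, size us = k & chain e p z us.
Proof.
elim: k z => [|k IH] z zM; first by exists [::] => //=; rewrite zM.
rewrite remaining_step => /and3P[zS zL _].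
move: zL; rewrite inE zS /= negb_forall_in => /exists_inP[u uS].
rewrite negb_imply -leqNgt => /andP[ezu leu].
have ltu : p u < p z.
  rewrite ltn_neqAle leu andbT; apply/eqP => /pos_inj E.
  by move: ezu; rewrite E eirr.
have uM : u \notin M.
  by apply/negP => uM; have := mis_indep esym eirr pos_inj zM uM; rewrite ezu.
have [mM emu ltm _] := killerP uM.
have mS : killer e p u \in S k.
  apply/negPn/negP => mS; have := remaining_clean mM mS (u := u).
  by rewrite esym emu uS => /(_ isT).
have [us sz ch] := IH _ mM mS.
by exists (u :: us); rewrite /= ?sz // zM esym ezu ltm ltu ch.
Qed.

Lemma nonempty_chain k : S k != set0 -> exists z us, size us = k /\ chain e p z us.
Proof.
case/set0Pn => v0 v0S.
case: (@arg_minnP _ v0 (fun v => v \in S k) p v0S) => z zS mz.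
have zM : z \in M.
  apply: (subsetP (local_minima_mis (remaining_clean (k := k)))).
  rewrite inE zS; apply/forall_inP => u uS; apply/implyP => ezu.
  rewrite ltn_neqAle mz // andbT; apply/eqP => /pos_inj E.
  by move: ezu; rewrite E eirr.
by have [us sz ch] := remaining_chain zM zS; exists z, us.
Qed.

Lemma num_rounds_chain k : k < num_rounds e pi ->
  exists z us, size us = k /\ chain e p z us.
Proof.
move=> lt; apply: nonempty_chain; apply/negP => /eqP E.
have ltn : k < n.+1.
  by apply: leq_trans lt _; have := find_size (fun k => S k == set0) (iota 0 n.+1); rewrite size_iota.
by have := before_find 0 lt; rewrite nth_iota // add0n E eqxx.
Qed.

End Rounds.

(** * Labels and decoding *)

Section Local.
Variables (T : finType) (e : rel T).

(** Membership of a vertex is decided by the earlier ones. The decoder can therefore read the MIS of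
    the original labelling off a partially restored one. *)
Lemma mis_local (p q : T -> nat) k :
  (forall w, (p w < k) || (q w < k) -> p w = q w) ->
  forall v, p v < k -> (v \in mis e p) = (v \in mis e q).
Proof.
move=> E v; have [j] := ubnP (p v); elim: j v => // j IH v lj ltk.
have Ev : p v = q v by apply: E; rewrite ltk.
rewrite !mis_greedy; apply: eq_forallb => u.
have [euv|_] := boolP (e u v); last by rewrite !implybT.
rewrite -Ev /=; have [le|lt] := leqP (p v) (p u).
  suff -> : p v <= q u by rewrite !implybT.
  rewrite leqNgt; apply/negP => lq.
  by have := E u; rewrite (ltn_trans lq ltk) orbT => /(_ isT); lia.
have ltuk := ltn_trans lt ltk.
by rewrite -(E u) ?ltuk // IH //; lia.
Qed.

End Local.

Section Labels.
Variables (n N : nat) (e : rel 'I_n).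
Hypotheses (esym : symmetric e) (eirr : irreflexive e).
Local Notation V := 'I_n.
Local Notation Lab := {ffun V -> 'I_N}.
Implicit Types (f g h : Lab) (u v w z : V).

(* Ties between labels are broken by the vertex number. *)
Definition keyv (t : nat) (v : V) := t * n + v.
Definition key f v := keyv (f v) v.

Lemma keyv_lt t t' v v' : t < t' -> keyv t v < keyv t' v'.
Proof. by move=> lt; rewrite /keyv; have := ltn_ord v; nia. Qed.

Lemma keyv_lt_le t t' v v' : keyv t v < keyv t' v' -> t <= t'.
Proof. by move=> lt; rewrite leqNgt; apply/negP => /(@keyv_lt _ _ v' v); lia. Qed.

Lemma keyv_lt_le' t t' v v' : keyv t v <= keyv t' v' -> t <= t'.
Proof. by move=> le; rewrite leqNgt; apply/negP => /(@keyv_lt _ _ v' v); lia. Qed.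

Lemma keyv_inj t t' v v' : keyv t v = keyv t' v' -> v = v'.
Proof.
move=> E; have [lt|lt|Et] := ltngtP t t'.
- by have := keyv_lt v v' lt; rewrite E ltnn.
- by have := keyv_lt v' v lt; rewrite E ltnn.
by apply/val_inj; move: E; rewrite /keyv Et => /addnI.
Qed.

Lemma key_inj f : injective (key f).
Proof. by move=> u v /keyv_inj. Qed.

Definition upd f v t : Lab := [ffun w => if w == v then t else f w].

(* Inverse of [newlab], see [restore_code]; the leading binary digit of the code
   [c] gives the scale and the other digits the remainder. *)
Definition restore (a t c : nat) :=
  let F := 2 ^ trunc_log 2 c in a + (t - a %/ 16) * F + (c - F).

(* The recovered MIS vertices [ms] and the last recovered [u_i], if [m_{i+1}] has
   not been recovered yet; none of them may be killed at this time. *)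
Definition guards (ms : seq V) (ou : option V) : {set V} :=
  [set x in oapp (fun u => u :: ms) ms ou].

Variable v0 : V.

(* A code [Some c] stands for a path vertex, [None] for a vertex whose old label is
   stored in the second labelling [h]. *)
Fixpoint decode (cs : seq (option nat)) g h ms ou : Lab * Lab * seq V * seq V :=
  if cs is c :: cs' then
    let v := first_killer e v0 (key g) (guards ms ou) in
    if c is Some c then
      let g' := upd g v (insubd (g v) (restore (g (head v0 ms)) (g v) c)) in
      let: (g1, h1, ch, zs) :=
        if ou is Some _ then decode cs' g' h (v :: ms) None
        else decode cs' g' h ms (Some v) in
      (g1, h1, v :: ch, zs)
    else
      let: (g1, h1, ch, zs) := decode cs' (upd g v (h v)) (upd h v (g v)) ms ou in
      (g1, h1, ch, v :: zs)
  else (g, h, [::], [::]).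

Local Notation step := (V * 'I_N * option nat)%type.
Implicit Types (sc : seq step).

(** [patch] and [hpatch] form the pair from which [decode] starts: the first carries the new labels,
    the second keeps the old labels of the vertices moved without a code, whose new label was their
    value under [h]. *)
Definition patch f sc : Lab := foldr (fun x g => upd g x.1.1 x.1.2) f sc.
Definition hpatch f h sc : Lab :=
  foldr (fun x g => if x.2 is None then upd g x.1.1 (f x.1.1) else g) h sc.

(* A step [(v, t, c)] says that [v] was moved to label [t] with code [c]. *)
Fixpoint valid f h ms ou sc : Prop :=
  if sc is (v, t, c) :: sc' then
    [/\ exists2 k, k \in guards ms ou & e v k,
        forall w k, w \in mis e (key f) -> k \in v |: guards ms ou -> e w k ->
          keyv t v <= key f w,
        t < f v,
        forall x, x \in sc' -> keyv t v < keyv x.1.2 x.1.1 &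
        [/\ v \notin [seq x.1.1 | x <- sc'], v \notin ms, 
        if c is Some c then restore (f (head v0 ms)) t c = f v else h v = t &
        if c is None then valid f h ms ou sc' else
        if ou is Some _ then valid f h (v :: ms) None sc' else valid f h ms (Some v) sc']]
  else True.

Lemma valid_label f h ms ou sc : valid f h ms ou sc ->
  forall x, x \in sc -> x.1.2 < f x.1.1 /\ x.1.1 \notin ms.
Proof.
elim: sc ms ou => //= -[[v t] c] sc IH ms ou [_ _ lt _ [_ vms _ H]] x.
rewrite inE => /orP[/eqP-> //|xsc].
case: c H => [c|] H; last exact: IH H _ xsc.
case: ou H => [u|] H; last exact: IH H _ xsc.
by have [l1] := IH _ _ H _ xsc; rewrite inE negb_or => /andP[_ ?].
Qed.

Lemma patch_notin f sc v : v \notin [seq x.1.1 | x <- sc] -> patch f sc v = f v.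
Proof. by elim: sc => //= x sc IH; rewrite inE negb_or ffunE => /andP[/negbTE-> /IH]. Qed.

Lemma hpatch_notin f h sc v : v \notin [seq x.1.1 | x <- sc] -> hpatch f h sc v = h v.
Proof.
elim: sc => //= -[[w t] c] sc IH /=; rewrite inE negb_or => /andP[/negbTE nvw /IH E].
by case: c => [c|]; rewrite ?ffunE ?nvw.
Qed.

Lemma patch_in f sc v : v \in [seq x.1.1 | x <- sc] ->
  exists2 x, x \in sc & x.1.1 = v /\ patch f sc v = x.1.2.
Proof.
elim: sc => //= x sc IH; rewrite inE ffunE; case: eqP => [->|_] /= H.
  by exists x; rewrite ?mem_head.
by have [y yin [E1 E2]] := IH H; exists y; rewrite // inE yin orbT.
Qed.

Lemma upd_patchK f sc v t : v \notin [seq x.1.1 | x <- sc] ->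
  upd (upd (patch f sc) v t) v (f v) = patch f sc.
Proof.
move=> vn; apply/ffunP => w; rewrite !ffunE.
by case: eqP => // ->; rewrite patch_notin.
Qed.

(** Moves are undone in increasing order of new key. Below the key of the current step the patched
    labelling agrees with [f] and so has the same MIS there; hence no earlier vertex kills [v] or a
    guard, and [v] is the first killer of the guards. *)
Lemma decode_patch f h ms ou sc : valid f h ms ou sc -> head v0 ms \in ms ->
  decode [seq x.2 | x <- sc] (patch f sc) (hpatch f h sc) ms ou =
  (f, h, [seq x.1.1 | x <- sc & isSome x.2], [seq x.1.1 | x <- sc & ~~ isSome x.2]).
Proof.
elim: sc ms ou => //= -[[v t] c] sc IH ms ou val hms.
have vlab := valid_label (sc := (v, t, c) :: sc) val.
case: val => /= -[k kK evk] noearly lt later [vsc vms cc H].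
set g := upd _ v t.
have gv : g v = t by rewrite ffunE eqxx.
have kg : key g v = keyv t v by rewrite /key gv.
have agree w : (key f w < keyv t v) || (key g w < keyv t v) -> key f w = key g w.
  rewrite /key ffunE; case: eqP => [-> /=|nwv].
    by rewrite ltnn orbF => /keyv_lt_le; rewrite leqNgt lt.
  case: (boolP (w \in [seq x.1.1 | x <- sc])) => [win|wn]; last by rewrite patch_notin.
  have [x xin [<- ->]] := patch_in f win.
  have l1 := later x xin.
  have [l2 _] : x.1.2 < f x.1.1 /\ x.1.1 \notin ms by apply: vlab; rewrite inE xin orbT.
  by rewrite !ltnNge (ltnW l1) (ltnW (ltn_trans l1 (keyv_lt _ _ l2))).
have loc := mis_local e agree.
have early w k' : w \in mis e (key g) -> k' \in v |: guards ms ou -> e w k' ->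
    key g v <= key g w.
  move=> wM k'K ewk'; rewrite leqNgt; apply/negP; rewrite kg => ltw.
  have E : key f w = key g w by apply: agree; rewrite ltw orbT.
  move: wM; rewrite -loc ?E // => wM.
  by have := noearly w k' wM k'K ewk'; rewrite E leqNgt ltw.
have vM : v \in mis e (key g).
  rewrite mis_greedy; apply/forall_inP => u uM; apply/implyP => euv.
  exact: early uM (setU11 _ _) euv.
have fkE : first_killer e v0 (key g) (guards ms ou) = v.
  apply: first_killer_eq (@key_inj g) vM kK evk _ => w k' wM k'K.
  by apply: early => //; rewrite inE k'K orbT.
rewrite fkE gv.
(* The label from which [restore] measures distances is an original one, as [ms] contains no vertex
   still to be restored. *)
have hdn : head v0 ms \notin [seq x.1.1 | x <- (v, t, c) :: sc].
  apply/mapP => -[x xin E]; have [_] := vlab x xin; by rewrite -E hms.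
have -> : g (head v0 ms) = f (head v0 ms).
  exact: (patch_notin (sc := (v, t, c) :: sc) f hdn).
case: c cc H {vlab hdn} => [c|] cc H /=.
  have -> : upd g v (insubd t (restore (f (head v0 ms)) t c)) = patch f sc.
    by rewrite cc valKd upd_patchK.
  case: ou H {kK noearly early fkE} => [u|] H; rewrite IH //.
  by rewrite /= mem_head.
rewrite ffunE eqxx upd_patchK //.
have -> : upd (upd (hpatch f h sc) v (f v)) v t = hpatch f h sc.
  apply/ffunP => w; rewrite !ffunE; case: eqP => // ->.
  by rewrite hpatch_notin //; apply: val_inj.
by rewrite IH.
Qed.

End Labels.

(** * Rescaling a dependency path *)

Section Encode.
Variables (n N : nat) (e : rel 'I_n).
Hypotheses (esym : symmetric e) (eirr : irreflexive e).
Local Notation V := 'I_n.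
Local Notation Lab := {ffun V -> 'I_N}.
Local Notation step := (V * 'I_N * option nat)%type.
Implicit Types (f g h : Lab) (u v w z : V) (us : seq V) (sc : seq step).
Variable v0 : V.

Notation Mis f := (mis e (key f)).

Definition lkiller f u := killer e (key f) u.

Fixpoint lchain f z us :=
  (z \in Mis f) && (if us is u :: us' then
    [&& e u z, f (lkiller f u) < f u, f u < f z & lchain f (lkiller f u) us'] else true).

Lemma lchain_mis f z us : lchain f z us -> z \in Mis f.
Proof. by case: us => [|u us] /= /andP[]. Qed.

Lemma lchain_notin f z u us : lchain f z (u :: us) -> u \notin Mis f.
Proof.
move=> /= /and3P[zM euz _]; apply/negP => uM.
by have := mis_indep esym eirr (@key_inj _ _ f) uM zM; rewrite euz.
Qed.

Fixpoint start f z us := if us is u :: us' then start f (lkiller f u) us' else z.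
Fixpoint mlist f z us := z :: (if us is u :: us' then mlist f (lkiller f u) us' else [::]).
Fixpoint chlist f z us :=
  if us is u :: us' then chlist f (lkiller f u) us' ++ [:: u; z] else [::].

(* A label [f w] between [f a] and [f b] is moved below [f a]: distances to [f a]
   are divided by [scale f a b > 16 * f b / f a]. *)
Definition expo f a b : nat := trunc_log 2 (f b %/ f a).
Definition scale f a b := 2 ^ (expo f a b + 5).
Definition newlab f a b w := f a %/ 16 + (f w - f a) %/ scale f a b.
Definition code f a b w := scale f a b + (f w - f a) %% scale f a b.
Definition cstep f a b w : step := (w, insubd (f w) (newlab f a b w), Some (code f a b w)).

Fixpoint cscript f z us : seq step :=
  if us is u :: us' then
    cscript f (lkiller f u) us' ++ [:: cstep f (lkiller f u) z u; cstep f (lkiller f u) z z]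
  else [::].

Lemma cscript_chlist f z us : [seq x.1.1 | x <- cscript f z us] = chlist f z us.
Proof. by elim: us z => //= u us IH z; rewrite map_cat IH. Qed.

Lemma size_cscript f z us : size (cscript f z us) = (size us).*2.
Proof. by elim: us z => //= u us IH z; rewrite size_cat IH /=; lia. Qed.

(* Recovers the list [us] from the chronological list of path vertices. *)
Fixpoint pairs (l acc : seq V) :=
  if l is u :: _ :: l' then pairs l' (u :: acc) else acc.

Lemma pairs_chlist f z us : pairs (chlist f z us) [::] = us.
Proof.
have aux l u w acc' : ~~ odd (size l) -> pairs (l ++ [:: u; w]) acc' = u :: pairs l acc'.
  have [k] := ubnP (size l); elim: k l acc' => // k IH [|a [|b l]] //= acc' lt ev.
  by apply: IH; [lia|move: ev; rewrite negbK].
elim: us z => //= u us IH z; rewrite aux ?IH //.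
by rewrite -cscript_chlist size_map size_cscript odd_double.
Qed.

Lemma last_chlist f z us : last (start f z us) (chlist f z us) = z.
Proof. by case: us => //= u us; rewrite last_cat. Qed.

Definition state := (seq V * option V)%type.
Definition next (s : state) (x : step) : state :=
  if x.2 is Some _ then
    if s.2 is Some _ then (x.1.1 :: s.1, None) else (s.1, Some x.1.1)
  else s.

(** The clauses of [valid] that involve one step only, at the decoder state [s] before it. Order and
    distinctness are left to [valid_local], so path steps and spare steps can be checked
    separately. *)
Definition local f h (s : state) (x : step) :=
  [/\ exists2 k, k \in guards s.1 s.2 & e x.1.1 k,
      forall w k, w \in Mis f -> k \in x.1.1 |: guards s.1 s.2 -> e w k ->
        keyv x.1.2 x.1.1 <= key f w,
      x.1.2 < f x.1.1, x.1.1 \notin s.1 &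
      if x.2 is Some c then restore (f (head v0 s.1)) x.1.2 c = f x.1.1
      else h x.1.1 = x.1.2].

Definition skey (x : step) := keyv x.1.2 x.1.1.

Lemma valid_local f h s sc :
  sorted ltn [seq skey x | x <- sc] -> uniq [seq x.1.1 | x <- sc] ->
  (forall pre x post, sc = pre ++ x :: post -> local f h (foldl next s pre) x) ->
  valid e v0 f h s.1 s.2 sc.
Proof.
elim: sc s => //= -[[v t] c] sc IH [ms ou] /=.
rewrite path_sortedE; last exact: ltn_trans.
case/andP => /allP lts srt /andP[vn un] loc.
have [/= a1 a2 a3 a4 a5] := loc [::] _ _ erefl.
split=> //; first by move=> x xin; apply: lts; apply: map_f.
split=> //.
have rec : valid e v0 f h (next (ms, ou) (v, t, c)).1 (next (ms, ou) (v, t, c)).2 sc.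
  by apply: IH => // pre x post E; apply: (loc ((v, t, c) :: pre) x post); rewrite E.
by case: c {a5 loc lts} rec => [c|] //=; case: ou {a1 a2}.
Qed.

Lemma foldl_next_filter s sc : foldl next s sc = foldl next s [seq x <- sc | isSome x.2].
Proof. by elim: sc s => //= -[[v t] [c|]] sc IH s /=; rewrite IH. Qed.

Lemma foldl_cscript f z us :
  foldl next ([:: start f z us], None) (cscript f z us) = (mlist f z us, None).
Proof. by elim: us z => //= u us IH z; rewrite foldl_cat IH. Qed.

Lemma restore_code (a t k : nat) : a <= t ->
  restore a (a %/ 16 + (t - a) %/ 2 ^ k) (2 ^ k + (t - a) %% 2 ^ k) = t.
Proof.
move=> le; have F0 : 0 < 2 ^ k by rewrite expn_gt0.
have -> : restore a (a %/ 16 + (t - a) %/ 2 ^ k) (2 ^ k + (t - a) %% 2 ^ k) =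
          a + (t - a) %/ 2 ^ k * 2 ^ k + (t - a) %% 2 ^ k.
  rewrite /restore (_ : trunc_log 2 _ = k) ?addKn //.
  apply/trunc_log_eq; rewrite ?leq_addr //= expnS mul2n -addnn ltn_add2l.
  exact: ltn_pmod.
by rewrite -addnA -divn_eq subnKC.
Qed.

Section Numeric.
Variables (a b : nat).
Hypotheses (a0 : 0 < a) (ab : a < b).
Let E := trunc_log 2 (b %/ a).

Lemma expo_le : 2 ^ E * a <= b.
Proof.
have q0 : 0 < b %/ a by rewrite divn_gt0 // ltnW.
have /andP[le _] := trunc_log_bounds (isT : 1 < 2) q0.
by apply: leq_trans (leq_divM b a); rewrite leq_mul2r le orbT.
Qed.

Lemma expo_gt : b < 2 ^ E.+1 * a.
Proof.
have q0 : 0 < b %/ a by rewrite divn_gt0 // ltnW.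
have /andP[_ lt] := trunc_log_bounds (isT : 1 < 2) q0.
by rewrite -ltn_divLR.
Qed.

(** The divisor exceeds [16 * b / a], because [b < 2 ^ E.+1 * a]. A rescaled label is therefore at
    most [2 * (a %/ 16)]. *)
Lemma newlab_small t : t <= b -> (t - a) %/ 2 ^ (E + 5) <= a %/ 16.
Proof.
move=> tb; rewrite leq_divRL //.
have F0 : 0 < 2 ^ E by rewrite expn_gt0.
have H : (t - a) %/ 2 ^ (E + 5) * 2 ^ (E + 5) <= b.
  by apply: leq_trans (leq_divM _ _) _; lia.
have P5 : 2 ^ (E + 5) = 2 ^ E * 32 by rewrite expnD.
have := expo_gt; rewrite expnS; move: H; set q := _ %/ _; rewrite P5.
by move: q (2 ^ E) F0 => q P; nia.
Qed.

(** The new labels of a path step start at [a %/ 16] and end by [b %/ 16], where those of the next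
    step start; so the steps do not interleave. *)
Lemma newlab_top : a %/ 16 + (b - a) %/ 2 ^ (E + 5) <= b %/ 16.
Proof.
have le : (b - a) %/ 2 ^ (E + 5) <= (b - a) %/ 16.
  by apply: leq_div2l => //; rewrite expnD; have : 0 < 2 ^ E by [rewrite expn_gt0]; lia.
have := leq_divM a 16; have := leq_divM (b - a) 16.
rewrite leq_divRL //; lia.
Qed.

End Numeric.

Lemma div_sep (a t t' F : nat) : 0 < F -> a <= t -> t + F <= t' -> (t - a) %/ F < (t' - a) %/ F.
Proof.
move=> F0 at_ le; have -> : t' - a = 1 * F + (t - a + (t' - t - F)) by lia.
by rewrite divnMDl // add1n ltnS leq_div2r // leq_addr.
Qed.

Variables (X J : nat).
Hypotheses (X0 : 0 < X) (NE : N = 2 ^ J * X).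

(** A ratio of labels is at most [N / X = 2 ^ J], so the separation is at least every [scale]
    ([scale_le]), and rescaling keeps the path labels distinct and in order. *)
Definition nice f := (forall v, X <= f v) /\
  (forall u v, u != v -> f u < f v -> f u + 2 ^ (J + 5) <= f v).

Section Nice.
Variables (f : Lab).
Hypothesis fn : nice f.

Lemma nice_gt0 v : 0 < f v. Proof. by have [H _] := fn; have := H v; lia. Qed.

Lemma scale_le m z : f m < f z -> scale f m z <= 2 ^ (J + 5).
Proof.
move=> lt; rewrite /scale leq_exp2l // leq_add2r -(@leq_exp2l 2) //.
have := expo_le (nice_gt0 m) lt; rewrite -/(expo f m z).
have lz : f z < 2 ^ J * X by rewrite -NE.
have [H _] := fn; have := H m; move: lz.
move: (2 ^ expo f m z) (2 ^ J) => P Q h2 h1 h3.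
rewrite leqNgt; apply/negP => h; nia.
Qed.

Lemma newlab_lt m z w : f m < f z -> f w <= f z -> newlab f m z w * 8 <= f m.
Proof.
move=> lt le; have := newlab_small (nice_gt0 m) lt le; rewrite -/(expo f m z) -/(scale f m z).
rewrite /newlab; have := leq_divM (f m) 16; lia.
Qed.

Lemma cstepE m z w : f m < f z -> f w <= f z -> f m <= f w ->
  ((cstep f m z w).1.2 = newlab f m z w :> nat).
Proof.
move=> lt le le'; rewrite /cstep /= val_insubd ifT //.
by have := newlab_lt lt le; have := ltn_ord (f m); lia.
Qed.

Lemma cstep_lt m z w : f m < f z -> f w <= f z -> f m <= f w -> (cstep f m z w).1.2 < f m.
Proof. by move=> h1 h2 h3; rewrite cstepE //; have := newlab_lt h1 h2; have := nice_gt0 m; lia. Qed.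

Lemma nice_sep u w m z : f m < f z -> f u < f w -> f u + scale f m z <= f w.
Proof.
move=> lt lt'; have [_ S] := fn; apply: leq_trans (S u w _ lt'); last by apply: contraTneq lt' => ->; rewrite ltnn.
by rewrite leq_add2l scale_le.
Qed.

Lemma scale_gt0 m z : 0 < scale f m z. Proof. by rewrite expn_gt0. Qed.

Lemma lchain_lab f' z u us : lchain f' z (u :: us) ->
  [/\ e u z, f' (lkiller f' u) < f' u, f' u < f' z, f' (lkiller f' u) < f' z & lchain f' (lkiller f' u) us].
Proof. by move=> /= /and5P[_ euz l1 l2 ch]; rewrite (ltn_trans l1 l2). Qed.

Lemma cscript_top z us : lchain f z us ->
  forall x, x \in cscript f z us -> x.1.2 <= f z %/ 16.
Proof.
elim: us z => //= u us IH z /(@lchain_lab _ _ _ _)[_ l1 l2 l3 ch] x.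
have top : newlab f (lkiller f u) z z <= f z %/ 16 by exact: newlab_top (nice_gt0 _) l3.
rewrite mem_cat !inE => /orP[xin|/orP[]/eqP->].
- by apply: leq_trans (IH _ ch x xin) _; rewrite leq_div2r // ltnW.
- rewrite (cstepE l3 (ltnW l2) (ltnW l1)); apply: leq_trans top; rewrite /newlab leq_add2l leq_div2r //; lia.
by rewrite (cstepE l3 (leqnn _) (ltnW l3)).
Qed.

Lemma cscript_sorted z us : lchain f z us -> sorted ltn [seq skey x | x <- cscript f z us].
Proof.
elim: us z => //= u us IH z /(@lchain_lab _ _ _ _)[_ l1 l2 l3 ch].
rewrite map_cat sorted_pairwise; last exact: ltn_trans.
rewrite pairwise_cat -sorted_pairwise; last exact: ltn_trans.
rewrite IH //= !andbT /=.
have k1 : skey (cstep f (lkiller f u) z u) < skey (cstep f (lkiller f u) z z).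
  apply: keyv_lt; rewrite (cstepE l3 (ltnW l2) (ltnW l1)) (cstepE l3 (leqnn _) (ltnW l3)).
  rewrite /newlab ltn_add2l div_sep ?scale_gt0 ?(ltnW l1) //; exact: nice_sep.
rewrite k1 andbT; apply/allrelP => _ y /mapP[x xin ->]; rewrite !inE.
have k2 : skey x < skey (cstep f (lkiller f u) z u).
  apply: keyv_lt; rewrite (cstepE l3 (ltnW l2) (ltnW l1)); apply: leq_ltn_trans (cscript_top ch xin) _.
  rewrite /newlab -[X in X < _]addn0 ltn_add2l divn_gt0 ?scale_gt0 //.
  by have := nice_sep l3 l1; lia.
by case/orP => /eqP-> //; apply: ltn_trans k2 k1.
Qed.

Lemma chlist_le z us : lchain f z us -> forall w, w \in chlist f z us -> f w <= f z.
Proof.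
clear fn NE X0.
elim: us z => //= u us IH z /(@lchain_lab _ _ _ _)[_ l1 l2 l3 ch] w.
rewrite mem_cat !inE => /orP[/(IH _ ch)|/orP[]/eqP->]; lia.
Qed.

Lemma chlist_uniq z us : lchain f z us -> uniq (chlist f z us).
Proof.
elim: us z => //= u us IH z /(@lchain_lab _ _ _ _)[_ l1 l2 l3 ch].
have nuz : u != z by apply: contraTneq l2 => ->; rewrite ltnn.
rewrite cat_uniq IH //= !orbF !inE nuz andbT negb_or.
have H w : f (lkiller f u) < f w -> w \notin chlist f (lkiller f u) us.
  by rewrite ltnNge; apply: contraNN; apply: chlist_le.
by rewrite !H.
Qed.

Lemma mlist_mis z us w : lchain f z us -> w \in mlist f z us -> (w \in Mis f) && (f w <= f z).
Proof.
clear fn NE X0.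
elim: us z => [|u us IH] z ch /=; rewrite in_cons.
  by rewrite orbF => /eqP->; rewrite (lchain_mis ch) leqnn.
case/orP => [/eqP->|]; first by rewrite (lchain_mis ch) leqnn.
by have [_ l1 l2 l3 ch'] := lchain_lab ch; case/(IH _ ch')/andP => -> /=; lia.
Qed.

Lemma chlist_mem z us w : lchain f z us -> w \in chlist f z us ->
  (w \in us) || (w \in Mis f).
Proof.
elim: us z => [//|u us IH] z ch /=; have [_ _ _ _ ch'] := lchain_lab ch.
rewrite mem_cat !in_cons orbF => /or3P[/(IH _ ch')|->//|/eqP->].
  by case/orP => ->; rewrite ?orbT.
by rewrite (lchain_mis ch) orbT.
Qed.

(** The steps of a path, latest first, as pairs [(m_{i+1}, u_i)]; [m_i] is recovered as the killer
    of [u_i]. *)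
Fixpoint trans z us := if us is u :: us' then (z, u) :: trans (lkiller f u) us' else [::].

Lemma trans_mlist z us x : x \in trans z us -> x.1 \in mlist f z us.
Proof.
elim: us z => //= u us IH z; rewrite !in_cons => /orP[/eqP->|/IH->]; rewrite ?eqxx ?orbT //.
Qed.

Lemma trans_chlist z us x : x \in trans z us ->
  cstep f (lkiller f x.2) x.1 x.1 \in cscript f z us.
Proof.
elim: us z => //= u us IH z; rewrite mem_cat !in_cons => /orP[/eqP->|/IH->//].
by rewrite eqxx !orbT.
Qed.

Lemma trans_lt z us x : lchain f z us -> x \in trans z us -> f (lkiller f x.2) < f x.1.
Proof.
elim: us z => [//|u us IH] z /lchain_lab[_ _ _ l3 ch].
by rewrite in_cons => /orP[/eqP->//|]; apply: IH.
Qed.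

Lemma cat2_split (T : Type) (C A B : seq T) a b : C ++ [:: a; b] = A ++ B ->
  [\/ exists2 B', C = A ++ B' & B = B' ++ [:: a; b],
      A = C ++ [:: a] /\ B = [:: b] | A = C ++ [:: a; b] /\ B = [::]].
Proof.
elim: C A => [|c C IH] [|x A] /=.
- by move=> <-; constructor 1; exists [::].
- case=> <-; case: A => [|y A] /=; first by move=> <-; constructor 2.
  by case=> <-; case: A => [|//] /= <-; constructor 3.
- by move=> <-; constructor 1; exists (c :: C).
case=> <- /IH[[B' -> ->]|[-> ->]|[-> ->]]; first by constructor 1; exists B'.
  by constructor 2.
by constructor 3.
Qed.

Lemma in_guards (ms : seq V) (ou : option V) (k : V) : (k \in guards ms ou) = (k \in ms) || (ou == Some k).
Proof.
rewrite /guards inE; case: ou => [u|] /=; last by rewrite orbF.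
by rewrite in_cons orbC (inj_eq Some_inj) [u == k]eq_sym.
Qed.

Notation st0 z us := ([:: start f z us], None).

Lemma killer_le u w : u \notin Mis f -> w \in Mis f -> e w u -> key f (lkiller f u) <= key f w.
Proof. by move=> uM wM ewu; have [_ _ _ H] := killerP uM; apply: H. Qed.

(** MIS vertices have no MIS neighbours, so among the guards and the moved vertex only [u] can be
    killed. Its killers have keys at least that of [lkiller f u], and both [u] and [z] are moved
    below that label. *)
Lemma local_chain h z us A x B : lchain f z us -> cscript f z us = A ++ x :: B ->
  local f h (foldl next (st0 z us) A) x.
Proof.
elim: us z A x B => [|u us IH] z A x B; first by case: A.
move=> ch; have uM := lchain_notin ch; have zM := lchain_mis ch.
have [euz l1 l2 l3 ch'] := lchain_lab ch; rewrite /= => E.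
have [mM emu _ _] := killerP uM; rewrite -/(lkiller f u) in mM emu.
have indep w k : w \in Mis f -> k \in Mis f -> e w k = false.
  by move=> wM kM; apply: (mis_indep esym eirr (@key_inj _ _ f) wM kM).
have msM k : k \in mlist f (lkiller f u) us -> k \in Mis f.
  by move=> /(mlist_mis ch')/andP[].
case: (cat2_split E) => [[B' E1 E2]|[-> [-> _]]|[_ //]].
  case: B' E1 E2 => [|y B'] E1 [-> _]; last exact: IH ch' E1.
  rewrite cats0 in E1; rewrite -E1 foldl_cscript /local /=.
  have cs := cstepE l3 (ltnW l2) (ltnW l1); have cl := cstep_lt l3 (ltnW l2) (ltnW l1).
  split.
  - exists (lkiller f u); last by rewrite esym.
    by rewrite in_guards; case: (us) => [|? ?]; rewrite mem_head.
  - move=> w k wM; rewrite in_setU1 in_guards orbF => /orP[/eqP->|/msM kM]; last by rewrite indep.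
    move=> ewu; apply: leq_trans (killer_le uM wM ewu); exact: ltnW (keyv_lt _ _ cl).
  - exact: ltn_trans cl l1.
  - by apply: contra uM; apply: msM.
  rewrite /= in cs; rewrite cs (_ : head v0 _ = lkiller f u); last by case: (us).
  by apply: restore_code; apply: ltnW.
rewrite foldl_cat foldl_cscript /local /=.
have cs := cstepE l3 (leqnn _) (ltnW l3); have cl := cstep_lt l3 (leqnn _) (ltnW l3).
split.
- by exists u; rewrite ?in_guards ?eqxx ?orbT // esym.
- move=> w k wM; rewrite in_setU1 in_guards => /or3P[/eqP->|/msM kM|/eqP[<-]].
  + by rewrite indep.
  + by rewrite indep.
  move=> ewu; apply: leq_trans (killer_le uM wM ewu); exact: ltnW (keyv_lt _ _ cl).
- exact: ltn_trans cl l3.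
- by apply/negP => /(mlist_mis ch')/andP[_]; lia.
rewrite /= in cs; rewrite cs (_ : head v0 _ = lkiller f u); last by case: (us).
by apply: restore_code; apply: ltnW.
Qed.

(** What a spare vertex inserted after the prefix [A] may rely on: only a pending [u] among the
    guards can be killed, and while it is pending some path step still to come has its new label
    below the killer of [u]. *)
Lemma state_chain z us A B : lchain f z us -> cscript f z us = A ++ B ->
  let s := foldl next (st0 z us) A in
  [/\ forall k, k \in s.1 -> k \in Mis f,
      forall u, s.2 = Some u -> u \notin Mis f /\ exists2 y, y \in B & y.1.2 < f (lkiller f u) &
      forall x, x \in trans z us -> cstep f (lkiller f x.2) x.1 x.1 \in A -> x.1 \in s.1].
Proof.
elim: us z A B => [|u us IH] z A B.
  by move=> ch; case: A => //= _; split=> // k; rewrite inE => /eqP->; apply: lchain_mis ch.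
move=> ch; have uM := lchain_notin ch; have zM := lchain_mis ch.
have [euz l1 l2 l3 ch'] := lchain_lab ch; rewrite [cscript _ _ _]/= => E.
have nz (P : seq step) : {subset P <= cscript f (lkiller f u) us} -> cstep f (lkiller f u) z z \notin P.
  move=> sub; apply/negP => /sub/(map_f (fun x => x.1.1)); rewrite cscript_chlist /=.
  by move/(chlist_le ch'); lia.
case: (cat2_split E) => [[B' E1 E2]|[EA EB]|[EA EB]].
- have [h1 h2 h3] := IH _ _ _ ch' E1; split=> //.
    by move=> v /h2[vM [y yB ly]]; split=> //; exists y; rewrite // E2 mem_cat yB.
  move=> x; rewrite in_cons => /orP[/eqP-> /=|/h3 //].
  by rewrite (negbTE (nz _ _)) // E1 => y yA; rewrite mem_cat yA.
- rewrite EA foldl_cat /= foldl_cscript /=; split.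
  + by move=> k /(mlist_mis ch')/andP[].
  + move=> _ [<-]; split=> //; exists (cstep f (lkiller f u) z z); first by rewrite EB mem_head.
    exact: cstep_lt l3 (leqnn _) (ltnW l3).
  move=> x; rewrite in_cons => /orP[/eqP-> /=|/trans_mlist //].
  rewrite mem_cat (negbTE (nz _ _)) // mem_seq1 => /eqP[zu].
  by move: l2; rewrite zu ltnn.
rewrite EA foldl_cat /= foldl_cscript /=; split=> //.
  by move=> k; rewrite in_cons => /orP[/eqP->//|/(mlist_mis ch')/andP[]].
move=> x; rewrite !in_cons => /orP[/eqP-> /=|/trans_mlist ->]; rewrite ?eqxx ?orbT //.
Qed.

Definition codeval (c : option nat) := odflt 1 c.

(** Each code of a step from [m] to [z] is at most [64 * f z / f m], so the two codes of a step
    multiply to at most [2 ^ 12 * (f z / f m) ^ 2], and the ratios telescope. *)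
Lemma code_prod z us : lchain f z us ->
  \prod_(x <- cscript f z us) codeval x.2 * f (start f z us) ^ 2 <=
  2 ^ (12 * size us) * f z ^ 2.
Proof.
elim: us z => [|u us IH] z; first by rewrite big_nil.
case/lchain_lab => _ l1 l2 l3 ch; have {}IH := IH _ ch.
rewrite [cscript _ _ _]/= big_cat /= !big_cons big_nil muln1 /=.
have bound w : code f (lkiller f u) z w <= 2 * scale f (lkiller f u) z.
  by rewrite /code mul2n -addnn leq_add2l ltnW // ltn_pmod // scale_gt0.
have E : scale f (lkiller f u) z * f (lkiller f u) <= 32 * f z.
  by have := expo_le (nice_gt0 _) l3; rewrite -/(expo _ _ _) /scale expnD; lia.
have -> : 2 ^ (12 * (size us).+1) = 2 ^ (12 * size us) * 4096 by rewrite mulnS addnC expnD.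
rewrite mulnAC; apply: leq_trans (leq_mul IH (leq_mul (bound u) (bound z))) _.
rewrite -!mulnA leq_mul2l; apply/orP; right; move: E; rewrite -!mulnn.
move: (scale _ _ _) (nat_of_ord (f z)) (nat_of_ord (f (lkiller f u))) => F b a E.
by have := leq_mul E E; lia.
Qed.

Lemma code_gt0 z us x c : x \in cscript f z us -> x.2 = Some c -> 0 < c.
Proof.
elim: us z => //= u us IH z; rewrite mem_cat !in_cons orbF => /or3P[/IH//|/eqP->|/eqP->] [<-];
  by rewrite /code addn_gt0 scale_gt0.
Qed.

(* Conditions under which the spare vertex [v] can be moved to the label [h v]. *)
Definition hit h z us v := [/\ v \notin us, v \notin Mis f, h v < f v,
  forall w, w \in Mis f -> e w v -> h v < f w &
  exists2 x, x \in trans z us & e v x.1 && (f (lkiller f x.2) < 8 * h v)].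

(** Path steps and spare steps are merged into one script sorted by new key. The decoder meets the
    spares in that order, which is why only a permutation of [zs] comes back. *)
Lemma encode h z us zs : lchain f z us -> uniq zs ->
  (forall v, v \in zs -> hit h z us v) ->
  exists cs, exists2 gh : Lab * Lab,
    [/\ size cs = (size us).*2 + size zs,
       forall c, Some c \in cs -> 0 < c &
       \prod_(c <- cs) codeval c * X ^ 2 <= 2 ^ (12 * size us) * N ^ 2] &
    exists2 zs', perm_eq zs' zs &
      decode e v0 cs gh.1 gh.2 [:: start f z us] None = (f, h, chlist f z us, zs').
Proof.
move=> ch uz hz; pose sz := [seq (v, h v, None) : step | v <- zs].
pose le (x y : step) := skey x <= skey y.
have le_tr : transitive le by move=> ? ? ?; apply: leq_trans.
have le_tot : total le by move=> ? ?; apply: leq_total.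
pose sc := sort le (cscript f z us ++ sz).
have psc : perm_eq sc (cscript f z us ++ sz) by rewrite perm_sort.
have fsc : [seq x <- sc | isSome x.2] = cscript f z us.
  rewrite filter_sort // filter_cat [X in _ ++ X](_ : _ = [::]) ?cats0; last first.
    by rewrite /sz; elim: (zs).
  rewrite (_ : [seq x <- _ | _] = cscript f z us).
    apply: sorted_sort => //; have := cscript_sorted ch.
    rewrite sorted_map; apply: sub_sorted => x y /=; exact: ltnW.
  by elim: (us) (z) => //= u us' IH z'; rewrite filter_cat IH.
have fsz : perm_eq [seq x <- sc | ~~ isSome x.2] sz.
  rewrite (perm_trans (perm_filter _ psc)) // filter_cat [X in X ++ _](_ : _ = [::]).
    by rewrite /sz filter_map (eq_filter (a2 := predT)) ?filter_predT.
  by elim: (us) (z) => //= u us' IH z'; rewrite filter_cat IH.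
have usc : uniq [seq x.1.1 | x <- sc].
  rewrite (perm_uniq (perm_map _ psc)) map_cat cscript_chlist cat_uniq (chlist_uniq ch).
  rewrite -map_comp (eq_map (g := id)) // map_id uz andbT /=.
  apply/hasPn => v vz; have [vu vM _ _ _] := hz v vz.
  by apply: contraNN vu => /(chlist_mem ch); rewrite (negbTE vM) orbF.
have ssc : sorted ltn [seq skey x | x <- sc].
  rewrite ltn_sorted_uniq_leq sorted_map sort_sorted // andbT map_inj_in_uniq.
    by move: usc; apply: map_uniq.
  move=> x y xs ys /keyv_inj E.
  have := nth_uniq x.1.1 _ _ usc => /(_ (index x sc) (index y sc)).
  rewrite !size_map !index_mem !(nth_map x) ?index_mem // !nth_index //.
  move=> /(_ xs ys); rewrite E eqxx => H; have /eqP I : index x sc == index y sc by rewrite -H.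
  by rewrite -(nth_index x xs) I nth_index.
have val : valid e v0 f h [:: start f z us] None sc.
  have := @valid_local f h (st0 z us) sc ssc usc; apply => pre x post E.
  rewrite foldl_next_filter.
  have F : cscript f z us = [seq x <- pre | isSome x.2] ++ [seq x <- x :: post | isSome x.2].
    by rewrite -filter_cat -E fsc.
  case xE: x.2 => [c|]; first by move: F; rewrite /= xE /=; apply: local_chain.
  have xsz : x \in sz by rewrite -(perm_mem fsz) E mem_filter xE mem_cat mem_head orbT.
  case/mapP: xsz => v vz xv; have [vu vM lt ltM [y yt /andP[evy ly]]] := hz v vz.
  move: F; set A := filter _ pre; set B := filter _ (_ :: _) => F.
  have [h1 h2 h3] := state_chain ch F.
  have Bpost y' : y' \in B -> skey x < skey y'.
    rewrite /B /= xE /= mem_filter => /andP[_ yin].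
    move: ssc; rewrite E map_cat => /cat_sorted2[_] /=.
    rewrite path_sortedE; last exact: ltn_trans.
    by case/andP => /allP/(_ (skey y')) H _; apply: H; apply: map_f.
  rewrite /local xv /=; split=> //.
  (* [y.1] is already a guard: its new label is at most an eighth of the label of its predecessor,
     which is below [8 * h v], so its step precedes that of [v]. *)
  - exists y.1 => //; rewrite in_guards h3 //.
    have := trans_chlist yt; rewrite F mem_cat => /orP[//|/Bpost].
    rewrite xv /skey /= => /keyv_lt_le.
    have l1 := trans_lt ch yt; have l2 := ltnW l1.
    have := cstepE l1 (leqnn _) l2; rewrite /= => ->.
    move=> l3; have l4 := leq_trans (leq_mul l3 (leqnn 8)) (newlab_lt l1 (leqnn _)).
    by move: ly; rewrite mulnC ltnNge l4.
  (* The vertex killed is [v], an MIS guard or the pending [u]. For [u], the later step [y'] has a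
     new label at least [h v] and below that of the killer of [u]. *)
  - move=> w k wM; rewrite in_setU1 in_guards => /or3P[/eqP->|/h1 kM|/eqP/h2[kM [y' y'B ly']]] ewk.
    + exact: ltnW (keyv_lt _ _ (ltM w wM ewk)).
    + by have := mis_indep esym eirr (@key_inj _ _ f) wM kM; rewrite ewk.
    apply: leq_trans (killer_le kM wM ewk); apply: ltnW; apply: keyv_lt.
    have := Bpost _ y'B; rewrite xv /skey /= => /keyv_lt_le le'.
    exact: leq_ltn_trans le' ly'.
  by apply/negP => /h1; rewrite (negbTE vM).
exists [seq x.2 | x <- sc]; exists (patch f sc, hpatch f h sc); last first.
  exists [seq x.1.1 | x <- sc & ~~ isSome x.2].
    by rewrite (perm_trans (perm_map _ fsz)) // /sz -map_comp map_id_in.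
  by rewrite decode_patch ?mem_head // fsc cscript_chlist.
split.
- by rewrite size_map (perm_size psc) size_cat size_cscript size_map.
- move=> c /mapP[x xs xc]; apply: (@code_gt0 z us x c) => //.
  by rewrite -fsc mem_filter -xc.
rewrite big_map (perm_big _ psc) big_cat /= [X in _ * X * _]big1_seq ?muln1; last first.
  by move=> x /andP[_ /mapP[v _ ->]].
apply: leq_trans (leq_trans (code_prod ch) _).
  by rewrite leq_mul2l leq_exp2r //; have [-> _] := fn; rewrite orbT.
by rewrite leq_mul2l leq_exp2r // (ltnW (ltn_ord _)) orbT.
Qed.

End Nice.

End Encode.

(** * Counting *)

Lemma leq_expn m n k : m <= n -> m ^ k <= n ^ k.
Proof. by case: k => // k le; rewrite leq_exp2r. Qed.

Lemma uniq_map_inj (T1 T2 : eqType) (g : T1 -> T2) (s : seq T1) :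
  uniq [seq g x | x <- s] -> {in s &, injective g}.
Proof.
elim: s => //= a s IH /andP[na us] x y.
rewrite !in_cons => /orP[/eqP->|xs] /orP[/eqP->|ys] E //; last exact: IH us x y xs ys E.
  by move: na; rewrite E map_f.
by move: na; rewrite -E map_f.
Qed.

Section Tuples.
Variable T : finType.

Lemma big_tuple_cons (R : Type) (idx : R) (op : Monoid.com_law idx) k (F : k.+1.-tuple T -> R) :
  \big[op/idx]_t F t = \big[op/idx]_x \big[op/idx]_(t : k.-tuple T) F [tuple of x :: t].
Proof.
rewrite pair_big (reindex (fun p : T * k.-tuple T => [tuple of p.1 :: p.2])) //=.
exists (fun t => (thead t, [tuple of behead t])) => [[x t] _|t _] /=.
  by rewrite theadE; congr (_, _); apply: val_inj.
by rewrite [RHS]tuple_eta.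
Qed.

Lemma sum_tuple_prod (R : comNzRingType) (w : T -> R) k :
  (\sum_(t : k.-tuple T) \prod_(x <- t) w x = (\sum_x w x) ^+ k)%R.
Proof.
elim: k => [|k IH].
  rewrite expr0 (big_pred1 [tuple]) ?big_nil // => t; apply/esym/eqP; exact: tuple0.
rewrite big_tuple_cons exprS -IH big_distrl /=; apply: eq_bigr => x _.
by rewrite big_distrr /=; apply: eq_bigr => t _; rewrite big_cons.
Qed.

Definition tuples_in k (U : {set T}) := [set t : k.-tuple T | uniq t & all (mem U) t].

(** Coordinates are chosen one at a time; those already used take away at most [k * N] of the total
    weight. *)
Lemma sum_uniq_tuples (w : T -> nat) N k (U : {set T}) : (forall x, w x <= N) ->
  (\sum_(x in U) w x - k * N) ^ k <= \sum_(t in tuples_in k U) \prod_(x <- t) w x.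
Proof.
move=> wN; elim: k U => [|k IH] U.
  rewrite expn0 [X in _ <= X]big_mkcond (big_pred1 [tuple]) ?big_nil /= ?inE //.
  by move=> t; apply/esym/eqP; exact: tuple0.
rewrite [X in _ <= X]big_mkcond big_tuple_cons /=.
pose W := \sum_(x in U) w x.
have step x : x \in U -> w x * (W - N - k * N) ^ k <=
   \sum_(t : k.-tuple T) (if [tuple of x :: t] \in tuples_in k.+1 U then \prod_(y <- x :: t) w y else 0).
  move=> xU; apply: leq_trans (_ : w x * \sum_(t in tuples_in k (U :\ x)) \prod_(y <- t) w y <= _).
    rewrite leq_mul2l; apply/orP; right; apply: leq_trans (IH _).
    apply: leq_expn; rewrite /W (big_setD1 x) //=; have := wN x; lia.
  rewrite big_distrr /= [X in X <= _]big_mkcond /=; apply: leq_sum => t _.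
  rewrite !inE /= big_cons xU; case: ifP => // /andP[-> /allP al] //=.
  have xt : x \notin t by apply/negP => /al; rewrite !inE eqxx.
  have aU : all (mem U) t by apply/allP => y /al; rewrite !inE => /andP[].
  by rewrite xt aU.
apply: leq_trans (_ : W * (W - N - k * N) ^ k <= _).
  rewrite expnS leq_mul //; first exact: leq_subr.
  by rewrite mulSn subnDA.
rewrite /W big_distrl /= [X in X <= _]big_mkcond /=; apply: leq_sum => x _.
case: ifP => [/step|] //; exact.
Qed.

End Tuples.

Lemma card_windows (n N : nat) (P : 'I_n -> pred 'I_N) (zs : seq 'I_n) : uniq zs ->
  #|[set h : {ffun 'I_n -> 'I_N} | all (fun v => P v (h v)) zs]| =
  \prod_(v <- zs) #|P v| * N ^ (n - size zs).
Proof.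
move=> uz; pose F v : pred 'I_N := if v \in zs then P v else predT.
have -> : #|[set h : {ffun 'I_n -> 'I_N} | all (fun v => P v (h v)) zs]| = #|family F|.
  rewrite cardsE; apply: eq_card => h; apply/allP/familyP => H v; last first.
    by move=> vz; have := H v; rewrite /F vz.
  by rewrite /F; case: ifP => // vz; apply: H.
rewrite card_family foldrE big_image /= (bigID (mem zs)) /=; congr (_ * _).
  rewrite big_uniq //=; apply: eq_big => // v; rewrite /F => /= ->; exact: eq_card.
rewrite (eq_bigr (fun=> N)) => [|v]; last first.
  by rewrite /F => /negbTE->; rewrite card_ord.
rewrite prod_nat_const; congr (N ^ _).
have /card_uniqP E := uz; rewrite -E.
have := cardC (mem zs); rewrite card_ord => C.
by rewrite -[X in _ = X - _]C addKn.
Qed.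

(** * Code words of bounded product *)

Section Codes.
Local Open Scope ring_scope.

Lemma sum_inv_sqr (B : nat) : \sum_(c < B.+1) ((c%:R ^- 2) : rat) <= 2 - (B == 0%N)%:R * 2.
Proof.
case: B => [|B]; first by rewrite big_ord1 expr0n /= invr0 mul1r subrr.
(* Strengthened to [2 - 1 / B.+1] so that the induction telescopes. *)
rewrite /= mul0r subr0; apply: (@le_trans _ _ (2 - B.+1%:R^-1)); last by rewrite gerBl invr_ge0.
elim: B => [|B IH]; first by rewrite !big_ord_recr big_ord0 /= !expr2 mulr0 invr0.
rewrite big_ord_recr /=; apply: le_trans (lerD IH (lexx _)) _.
have -> : (B.+2)%:R = B.+1%:R + 1 :> rat by rewrite -natr1.
have : (0 : rat) < B.+1%:R by rewrite ltr0n.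
move: (B.+1%:R : rat) => x p1; have p2 : 0 < x + 1 by rewrite addr_gt0.
rewrite -subr_ge0.
have -> : 2 - (x + 1)^-1 - (2 - x^-1 + (x + 1) ^- 2) = (x * (x + 1) ^+ 2)^-1.
  by field; rewrite !gt_eqF.
by rewrite invr_ge0 mulr_ge0 ?exprn_ge0 // ltW.
Qed.

(* The letter [0] plays the role of [None], hence counts as a factor 1. *)
Definition goodcode B k (t : k.-tuple 'I_B.+1) :=
  (\prod_(c <- t) (if c == 0 :> nat then 1 else c) <= B)%N.

(** Rankin's trick: a word with product at most [B] satisfies [1 <= (B / product) ^ 2]. Summed over
    all words this factorises over the letters, and each position contributes at most 3: 1 for the
    letter 0, and 2 for the sum of the inverse squares. *)
Lemma card_goodcode B k :
  (#|[set t : k.-tuple 'I_B.+1 | goodcode t]| <= B ^ 2 * 3 ^ k)%N.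
Proof.
pose w (c : 'I_B.+1) : rat := if c == 0 :> nat then 1 else c%:R ^- 2.
rewrite -(ler_nat rat) natrM !natrX.
apply: (@le_trans _ _ (B%:R ^+ 2 * \sum_(t : k.-tuple 'I_B.+1) \prod_(c <- t) w c)).
  rewrite -sum1_card natr_sum big_distrr /= big_mkcond; apply: ler_sum => t _.
  have w0 c : 0 <= w c by rewrite /w; case: ifP => // _; rewrite invr_ge0 exprn_ge0.
  case: ifP => [|_]; last by rewrite mulr_ge0 ?exprn_ge0 // prodr_ge0.
  rewrite inE /goodcode => le.
  have -> : \prod_(c <- t) w c = (\prod_(c <- t) (if c == 0 :> nat then 1 else c))%N%:R ^- 2.
    rewrite natr_prod -prodrXl -prodfV; apply: eq_bigr => c _; rewrite /w.
    by case: ifP => // _; rewrite expr1n invr1.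
  have gt : (0 < \prod_(c <- t) (if c == 0 :> nat then 1 else c))%N.
    by rewrite prodn_gt0 // => c; case: ifP => // /negbT; rewrite lt0n.
  rewrite -[X in X <= _](@mulfV _ ((\prod_(c <- t) (if c == 0 :> nat then 1 else c))%N%:R ^+ 2)).
    by rewrite ler_wpM2r ?invr_ge0 ?exprn_ge0 // lerXn2r ?nnegrE // ler_nat.
  by rewrite expf_neq0 // pnatr_eq0 -lt0n.
rewrite sum_tuple_prod ler_wpM2l ?exprn_ge0 // lerXn2r ?nnegrE //.
  by apply: sumr_ge0 => c _; rewrite /w; case: ifP => // _; rewrite invr_ge0 exprn_ge0.
rewrite (_ : 3%:R = 1 + 2%:R) //.
have -> : \sum_c w c = 1 + \sum_(c < B.+1) ((c%:R ^- 2) : rat).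
  rewrite !big_ord_recl /= expr0n /= invr0 add0r; congr (_ + _).
rewrite lerD2l; apply: le_trans (sum_inv_sqr B) _.
by rewrite gerBl mulr_ge0.
Qed.

End Codes.

(** * Encoding bound for paths with many spare positions *)

Section Stage1.
Variables (n N : nat) (e : rel 'I_n).
Hypotheses (esym : symmetric e) (eirr : irreflexive e).
Local Notation V := 'I_n.
Local Notation Lab := {ffun V -> 'I_N}.
Variables (v0 : V) (X J : nat).
Hypotheses (X0 : 0 < X) (NE : N = 2 ^ J * X).
Variables (L Q : nat).
Let B := 2 ^ (12 * L + 2 * J).
Local Notation path := (Lab * V * L.-tuple V)%type.
Local Notation object := (path * (Lab * Q.-tuple V))%type.
Local Notation coded := (Lab * Lab * V * (L.*2 + Q).-tuple 'I_B.+1 * 'I_(Q`!))%type.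

Definition decode1 (c : 'I_B.+1) : option nat := if c == 0 :> nat then None else Some (c : nat).

Lemma codes_tuple (cs : seq (option nat)) k : size cs = k ->
  (forall c, Some c \in cs -> 0 < c) -> \prod_(c <- cs) codeval c <= B ->
  exists2 t : k.-tuple 'I_B.+1, [seq decode1 c | c <- t] = cs & goodcode t.
Proof.
move=> sz pos le; pose enc (c : option nat) : 'I_B.+1 := inord (odflt 0 c).
have encE c : c \in cs -> enc c = odflt 0 c :> nat.
  case: c => [c|] cin; last by rewrite inordK.
  rewrite inordK // ltnS; apply: leq_trans le; rewrite (big_rem _ cin) /=.
  apply: leq_pmulr; rewrite big_seq_cond prodn_cond_gt0 // => -[d|] // /andP[/mem_rem/pos].
  by [].
have sz' : size [seq enc c | c <- cs] == k by rewrite size_map sz.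
exists (Tuple sz') => /=.
  rewrite -map_comp map_id_in // => c cin /=; rewrite /decode1 encE //.
  by case: c cin => [c /pos|] //=; case: c.
rewrite /goodcode /= big_map big_seq; apply: leq_trans le; rewrite [X in _ <= X]big_seq.
by apply: leq_prod => c cin; rewrite encE //; case: c cin => //= c /pos; case: c.
Qed.

(** Since [decode] lists the spares by new key, their original order is stored as an index among the
    permutations. The defaults of [insubd] do not occur on encodings of objects. *)
Definition undo (c : coded) : object :=
  let: (g, h', m0, cs, i) := c in
  let: (f, h, ch, zs) := decode e v0 [seq decode1 c | c <- cs] g h' [:: m0] None in
  ((f, last m0 ch, insubd (nseq_tuple L v0) (pairs ch [::])),
   (h, insubd (nseq_tuple Q v0) (nth [::] (permutations zs) i))).

Variables (A : {set path}) (U : path -> {set V}) (win : path -> V -> pred 'I_N) (W : nat).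
Hypothesis Achain : forall a, a \in A -> nice X J a.1.1 /\ lchain e a.1.1 a.1.2 a.2.
Hypothesis Uhit : forall a h v, a \in A -> v \in U a -> win a v ((h : Lab) v) ->
  hit e a.1.1 h a.1.2 a.2 v.
Hypothesis Wsum : forall a, a \in A -> W <= \sum_(v in U a) #|win a v|.

Definition objects : {set object} :=
  [set o | [&& o.1 \in A, o.2.2 \in tuples_in Q (U o.1) &
            all (fun v => win o.1 v ((o.2.1 : Lab) v)) o.2.2]].

Lemma card_objects : #|A| * (W - Q * N) ^ Q * N ^ (n - Q) <= #|objects|.
Proof.
rewrite -[X in _ <= X]sum1_card [X in _ <= X]big_mkcond /=.
rewrite [X in _ <= X](eq_bigr (fun o : object => if o.1 \in A then
    (if (o.2.2 \in tuples_in Q (U o.1)) then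
      (if all (fun v => win o.1 v ((o.2.1 : Lab) v)) o.2.2 then 1 else 0) else 0) else 0)); last first.
  by move=> o _; rewrite in_set; case: (o.1 \in A); case: (o.2.2 \in _).
rewrite -(pair_big predT predT (fun (a : path) (b : Lab * Q.-tuple V) => if a \in A then
    (if (b.2 \in tuples_in Q (U a)) then
      (if all (fun v => win a v ((b.1 : Lab) v)) b.2 then 1 else 0) else 0) else 0)) /=.
rewrite -mulnA -sum1_card big_distrl /= [X in X <= _]big_mkcond /=; apply: leq_sum => a _.
case: ifP => aA; last by [].
rewrite mul1n -(pair_big predT predT (fun (h : Lab) (t : Q.-tuple V) =>
    if t \in tuples_in Q (U a) then (if all (fun v => win a v (h v)) t then 1 else 0) else 0)) /=.
rewrite exchange_big /=.
have wN v : #|win a v| <= N by rewrite -[X in _ <= X]card_ord max_card.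
apply: leq_trans (_ : (\sum_(t in tuples_in Q (U a)) \prod_(x <- t) #|win a x|) * N ^ (n - Q) <= _).
  rewrite leq_mul2r; apply/orP; right; apply: leq_trans (sum_uniq_tuples _ _ wN).
  by apply: leq_expn; rewrite leq_sub2r // Wsum.
rewrite big_distrl /= [X in X <= _]big_mkcond /=; apply: leq_sum => t _.
case: ifP => // tU; move: (tU); rewrite inE => /andP[ut _].
rewrite -big_mkcond /= sum1dep_card (card_windows (win a) ut) size_tuple //.
Qed.

Lemma objects_undo : objects \subset undo @: [set c : coded | goodcode c.1.2].
Proof.
apply/subsetP => -[[[f z] us] [h zs]]; rewrite !inE /= => /and3P[aA /andP[uz /allP zU] /allP hw].
have [fn ch] := Achain aA.
have hz v : v \in zs -> hit e f h z us v.
  by move=> vz; apply: (Uhit (a := (f, z, us))) => //; [apply: zU|apply: hw].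
have [cs [[g h'] [sz pos le] [zs' pz dec]]] := encode esym eirr v0 X0 NE fn ch uz hz.
rewrite !size_tuple in sz le.
have leB : \prod_(c <- cs) codeval c <= B.
  have X2 : 0 < X ^ 2 by rewrite expn_gt0 X0.
  rewrite -(leq_pmul2r X2); apply: leq_trans le _.
  by rewrite NE expnMn -expnM mulnA -expnD [J * 2]mulnC.
have [t tE tg] := codes_tuple sz pos leB.
have uz' : uniq zs' by rewrite (perm_uniq pz).
have szz : size zs' = Q by rewrite (perm_size pz) size_tuple.
have zp : val zs \in permutations zs' by rewrite mem_permutations perm_sym.
have ip : index (val zs) (permutations zs') < Q`!.
  by have := zp; rewrite -index_mem size_permutations // szz.
apply/imsetP; exists (g, h', start e f z us, t, Ordinal ip); first by rewrite inE.
rewrite /undo tE dec last_chlist pairs_chlist /= nth_index //.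
by congr (_, _, (_, _)); apply: val_inj; rewrite val_insubd size_tuple eqxx.
Qed.

(** Double counting of the objects: from below by choosing the spares and their new labels for each
    path of [A], from above by the number of codes, since [undo] covers all objects. *)
Theorem stage1 :
  #|A| * (W - Q * N) ^ Q * N ^ (n - Q) <= N ^ n * N ^ n * n * (B ^ 2 * 3 ^ (L.*2 + Q)) * Q`!.
Proof.
apply: leq_trans card_objects (leq_trans (subset_leq_card objects_undo) _).
apply: leq_trans (leq_imset_card _ _) _.
rewrite (_ : [set c : coded | _] = setX (setX setT [set t | goodcode t]) setT); last first.
  by apply/setP => -[[x t] i]; rewrite !inE /= andbT.
rewrite !cardsX !cardsT !card_prod card_ffun !card_ord leq_mul //.
by rewrite leq_mul // card_goodcode.
Qed.

End Stage1.

(** * Cells and loads *)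

Section Grid.
Variables (N R X : nat).
Hypotheses (R0 : 0 < R) (X0 : 0 < X) (XN : X <= N).

(** A cell is short compared both to its start and to the distance of its start from [N]: inside it,
    labels and the numbers of labels above them vary only by small factors. *)
Fixpoint grid g := if g is g'.+1 then grid g' + minn (grid g') (N - grid g') %/ (2 * R) else X.

Lemma gridS g : grid g.+1 = grid g + minn (grid g) (N - grid g) %/ (2 * R).
Proof. by []. Qed.

Lemma grid_mono g g' : g <= g' -> grid g <= grid g'.
Proof.
move/subnK <-; elim: (g' - g) => // k IH; rewrite addSn gridS.
exact: leq_trans IH (leq_addr _ _).
Qed.

Lemma grid_ge g : X <= grid g. Proof. exact: grid_mono (leq0n g). Qed.

Lemma gridS_le g : grid g.+1 <= 2 * grid g.
Proof.
clear R0 X0 XN.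
have := leq_div (minn (grid g) (N - grid g)) (2 * R); have := geq_minl (grid g) (N - grid g).
by rewrite gridS; lia.
Qed.

Lemma grid_le g : grid g <= N.
Proof.
clear R0 X0.
elim: g => // g IH; have := leq_div (minn (grid g) (N - grid g)) (2 * R).
by have := geq_minr (grid g) (N - grid g); rewrite gridS; lia.
Qed.

Variable Jf : nat.
(** The index of the cell containing [t], written as a count so that monotonicity is immediate;
    labels from [grid Jf] on get the index [Jf]. *)
Definition cell t := count (fun g => grid g.+1 <= t) (iota 0 Jf).

Lemma cell_mono t t' : t <= t' -> cell t <= cell t'.
Proof. by move=> le; apply: sub_count => g /= /leq_trans; apply. Qed.

Lemma cell_eq t g : g < Jf -> grid g <= t < grid g.+1 -> cell t = g.
Proof.
move=> gJ /andP[le lt]; rewrite /cell -(subnKC (ltnW gJ)) iotaD count_cat add0n.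
rewrite (_ : count _ (iota 0 g) = g); last first.
  rewrite -[RHS](size_iota 0 g); apply/eqP; rewrite -all_count; apply/allP => i.
  by rewrite mem_iota add0n => /andP[_ ig]; apply: leq_trans (grid_mono ig) le.
rewrite (_ : count _ _ = 0) ?addn0 //; apply/eqP; rewrite -leqn0 leqNgt -has_count.
apply/hasPn => i; rewrite mem_iota => /andP[gi _]; rewrite -ltnNge.
by apply: leq_trans lt _; apply: grid_mono.
Qed.

Lemma cellP t : X <= t < grid Jf ->
  [/\ cell t < Jf, grid (cell t) <= t & t < grid (cell t).+1].
Proof.
case/andP => le lt; have [g gJ b] : exists2 g, g < Jf & grid g <= t < grid g.+1.
  elim: Jf lt => [|j IH]; first by rewrite /= ltnNge le.
  move=> lt; have [l|l] := ltnP t (grid j).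
    by have [g gj b] := IH l; exists g => //; apply: ltnW.
  by exists j => //; rewrite l.
by rewrite (cell_eq gJ b); case/andP: b.
Qed.

End Grid.

(** * Loads and spare vertices *)

Section Cells.
Variables (n N : nat) (e : rel 'I_n).
Hypotheses (esym : symmetric e) (eirr : irreflexive e).
Local Notation V := 'I_n.
Local Notation Lab := {ffun V -> 'I_N}.
Notation Mis f := (mis e (key f)).
Notation lkiller := (lkiller e).
Notation trans := (trans e).
Notation lchain := (lchain e).
Variables (v0 : V) (X J R Jf : nat).
Hypotheses (X1 : 1 < X) (R0 : 0 < R) (NE : N = 2 ^ J * X).
Notation grid := (grid N R X).
Notation cell := (cell N R X Jf).
Implicit Types (f h : Lab) (u v w z : V) (us : seq V).

Let X0 : 0 < X. Proof. exact: ltnW. Qed.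
Let XN : X <= N. Proof. by rewrite NE leq_pmull // expn_gt0. Qed.

(* The neighbours of [z] that are still undecided at time [grid g]. *)
Definition pend f z g : {set V} :=
  [set v | e v z && [forall w in Mis f, e w v ==> (grid g <= f w)]].

(** [tcell] is the cell of [m_i], and [tpend] is the set [D_i] of the step. *)
Definition tcell f (x : V * V) := cell (f (lkiller f x.2)).
Definition tpend f (x : V * V) := pend f x.1 (tcell f x).

Definition cellpend f z us g : {set V} :=
  [set v | has (fun x => (tcell f x == g) && (v \in tpend f x)) (trans f z us)].

Definition load f z us := \sum_(g < Jf) #|cellpend f z us g| * grid g.

Definition inrange f := forall v, X <= f v < grid Jf.

Lemma trans_chain f z us x : lchain f z us -> x \in trans f z us ->
  [/\ x.2 \notin Mis f, x.1 \in Mis f, f (lkiller f x.2) < f x.2, f x.2 < f x.1 & e x.2 x.1] /\ x.2 \in us.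
Proof.
elim: us z => [//|u us IH] z ch; rewrite in_cons => /orP[/eqP->/=|xin].
  have [euz l1 l2 _ _] := lchain_lab ch; rewrite mem_head.
  by rewrite (lchain_notin esym eirr ch) (lchain_mis ch) l1 l2 euz.
have [_ _ _ _ ch'] := lchain_lab ch; have [H xu] := IH _ ch' xin.
by split=> //; rewrite in_cons xu orbT.
Qed.

Lemma trans_order f z us x y : lchain f z us -> x \in trans f z us -> y \in trans f z us ->
  f (lkiller f x.2) < f (lkiller f y.2) -> f x.1 <= f (lkiller f y.2).
Proof.
elim: us z => [//|u us IH] z ch; have [_ _ _ _ ch'] := lchain_lab ch.
have top (t : V * V) : t \in trans f (lkiller f u) us -> f t.1 <= f (lkiller f u).
  by move=> /trans_mlist/(mlist_mis ch')/andP[].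
rewrite !in_cons => /orP[/eqP->|xin] /orP[/eqP->|yin] /=; rewrite ?ltnn //; last exact: IH ch' xin yin.
- have l := leq_trans (trans_lt ch' yin) (top _ yin); by rewrite ltnNge (ltnW l).
by move=> _; apply: top.
Qed.

Lemma pend_mis f z us x v w : lchain f z us -> x \in trans f z us -> v \in tpend f x ->
  w \in Mis f -> e w v -> grid (tcell f x) <= f w.
Proof.
move=> ch xin; rewrite inE => /andP[_ /forall_inP H] wM ewv.
exact: (implyP (H w wM)).
Qed.

Definition vcells f z us v : {set 'I_Jf} := [set g : 'I_Jf | v \in cellpend f z us g].

Lemma in_vcells f z us v g : (g \in vcells f z us v) = (v \in cellpend f z us g).
Proof. by rewrite in_set. Qed.

Lemma cellpendP f z us v g : reflect
  (exists2 x, x \in trans f z us & tcell f x = g /\ v \in tpend f x)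
  (v \in cellpend f z us g).
Proof.
rewrite inE; apply: (iffP hasP) => -[x xin].
  by case/andP => /eqP E vx; exists x.
by case=> E vx; exists x => //; rewrite E eqxx.
Qed.

(* Once [m_{i+1}] has joined, its neighbours are decided. *)
Lemma vcells_three f z us v (g1 g2 g3 : 'I_Jf) : lchain f z us -> inrange f ->
  g1 \in vcells f z us v -> g2 \in vcells f z us v -> g3 \in vcells f z us v ->
  g1 < g2 -> g2 < g3 -> False.
Proof.
move=> ch rg; rewrite !in_vcells => /cellpendP[x1 i1 [E1 d1]] /cellpendP[x2 i2 [E2 d2]].
move=> /cellpendP[x3 i3 [E3 d3]] l12 l23.
have lt12 : f (lkiller f x1.2) < f (lkiller f x2.2).
  rewrite ltnNge; apply/negP => /(cell_mono N R X Jf); rewrite -/(tcell f x1) -/(tcell f x2); lia.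
have le := trans_order ch i1 i2 lt12.
have [[_ z1M _ _ _] _] := trans_chain ch i1.
have e1 : e x1.1 v by move: d1; rewrite inE esym => /andP[].
have := pend_mis ch i3 d3 z1M e1; rewrite E3.
have [cl c1 c2] := cellP (rg (lkiller f x2.2)); rewrite -/(tcell f x2) E2 in c1 c2.
by have := grid_mono N R X l23; lia.
Qed.

Lemma vcells_le2 f z us v : lchain f z us -> inrange f -> #|vcells f z us v| <= 2.
Proof.
move=> ch rg; have [->|[g0 g0in]] := set_0Vmem (vcells f z us v); first by rewrite cards0.
case: (@arg_minnP _ g0 (fun g => g \in vcells f z us v) (@nat_of_ord Jf) g0in) => a ain amin.
case: (@arg_maxnP _ g0 (fun g => g \in vcells f z us v) (@nat_of_ord Jf) g0in) => b bin bmax.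
apply: leq_trans (_ : #|[set a; b]| <= 2); last by rewrite cards2; case: (a != b).
apply: subset_leq_card; apply/subsetP => g gin; rewrite !inE.
have l2 := amin g gin; have l1 : g <= b by exact: bmax g gin.
case: (eqVneq g b) => [E|nb]; first by rewrite ?orbT.
case: (eqVneq g a) => [E|na] //.
have ag : a < g.
  by rewrite ltn_neqAle l2 andbT; apply: contra na => /eqP/val_inj->.
have gb : g < b.
  by rewrite ltn_neqAle l1 andbT; apply: contra nb => /eqP/val_inj->.
by have := vcells_three ch rg ain gin bin ag gb.
Qed.

(* A vertex is pending for at most two cells, see [vcells_le2]. *)
Definition topcell f z us v := \max_(g in vcells f z us v) (g : nat).
Definition spare f z us : {set V} := [set v | (vcells f z us v != set0) && (v \notin us)].

(** Summed by vertices, the share of [v] is at most twice the start of its last cell, as [v] is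
    pending in at most two. The vertices [u_i] cannot serve as spares and are charged [2 * N]
    each. *)
Lemma load_le f z us : lchain f z us -> inrange f ->
  load f z us <= 2 * (\sum_(v in spare f z us) grid (topcell f z us v) + size us * N).
Proof.
move=> ch rg.
have -> : load f z us = \sum_v \sum_(g in vcells f z us v) grid g.
  rewrite /load (eq_bigr (fun g : 'I_Jf => \sum_(v in cellpend f z us g) grid g)); last first.
    by move=> g _; rewrite sum_nat_const.
  rewrite (exchange_big_dep predT) //=; apply: eq_bigr => v _.
  by apply: eq_bigl => g; rewrite in_vcells.
have b v : \sum_(g in vcells f z us v) grid g <= 2 * grid (topcell f z us v).
  apply: leq_trans (_ : #|vcells f z us v| * grid (topcell f z us v) <= _).
    rewrite -sum_nat_const; apply: leq_sum => g gin; apply: grid_mono.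
    exact: (leq_bigmax_cond (F := fun g : 'I_Jf => (g : nat)) g gin).
  by rewrite leq_mul2r vcells_le2 ?orbT.
rewrite (bigID (mem (spare f z us))) /= mulnDr leq_add //.
  by rewrite big_distrr /=; apply: leq_sum => v _; apply: b.
apply: leq_trans (_ : \sum_(v in us) 2 * N <= _); last first.
  rewrite sum_nat_const [_ * (2 * N)]mulnCA leq_mul2l leq_mul2r /= card_size orbT //.
rewrite big_mkcond [X in _ <= X]big_mkcond /=; apply: leq_sum => v _.
rewrite in_set; case: (boolP (v \in us)) => vu; last first.
  by rewrite andbT; case: eqP => //= ->; rewrite big_set0.
by rewrite andbF /=; apply: leq_trans (b v) _; rewrite leq_mul2l grid_le.
Qed.

(** Below the start [G] of the top cell no MIS neighbour of [v] has joined. The lower end [G / 2] is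
    beyond the new label of [m_{i+1}], which is at most an eighth of the label of [m_i], hence at
    most [G / 4]. *)
Definition window f z us v : pred 'I_N :=
  [pred t : 'I_N | grid (topcell f z us v) <= 2 * t & t < grid (topcell f z us v)].

Lemma card_window f z us v : grid (topcell f z us v) <= 4 * #|window f z us v|.
Proof.
set G := grid _; have G1 : 1 < G by apply: leq_trans (grid_ge _ _ _ _).
have GN : G <= N by exact: grid_le.
have ip (i : 'I_(G %/ 2)) : uphalf G + i < N.
  by apply: leq_trans GN; have := ltn_ord i; rewrite uphalf_half -divn2; lia.
have : #|codom (fun i : 'I_(G %/ 2) => Ordinal (ip i))| <= #|window f z us v|.
  apply: subset_leq_card; apply/subsetP => t /codomP[i ->]; rewrite inE /= -/G.
  by have := ltn_ord i; rewrite uphalf_half -divn2; lia.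
rewrite card_codom ?card_ord; last by move=> i j [] /addnI/val_inj.
lia.
Qed.

Lemma spare_hit f h z us v : lchain f z us -> inrange f -> v \in spare f z us ->
  window f z us v (h v) -> hit e f h z us v.
Proof.
move=> ch rg; rewrite in_set => /andP[vne vu] /andP[/= w1 w2].
have [g gin gtop] : exists2 g : 'I_Jf, g \in vcells f z us v & topcell f z us v = g.
  rewrite /topcell; have := @eq_bigmax_cond _ (mem (vcells f z us v)) (fun g => g : nat).
  by rewrite card_gt0 => /(_ vne)[g gin ->]; exists g.
move: w1 w2; rewrite gtop => w1 w2.
move: gin; rewrite in_vcells => /cellpendP[x xin [xg vx]].
have [[_ xM _ _ _] _] := trans_chain ch xin.
have evx : e v x.1 by move: vx; rewrite in_set => /andP[].
have vM : v \notin Mis f.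
  by apply/negP => vM; have := mis_indep esym eirr (@key_inj _ _ f) vM xM; rewrite evx.
have lw w : w \in Mis f -> e w v -> h v < f w.
  by move=> wM ewv; apply: leq_trans w2 _; rewrite -xg; apply: pend_mis ch xin vx wM ewv.
split=> //.
  have [mM emv /keyv_lt_le le _] := killerP vM.
  exact: leq_trans (lw _ mM emv) le.
exists x => //; rewrite evx /=; have [_ _ c] := cellP (rg (lkiller f x.2)).
rewrite -/(tcell f x) xg in c; apply: leq_trans c (leq_trans (gridS_le N R X g) _).
by apply: leq_trans (leq_mul (leqnn 2) w1) _; rewrite mulnA leq_mul2r orbT.
Qed.

Variable L : nat.
Let B := 2 ^ (12 * L + 2 * J).

(** The number of spares is taken equal to [L]. The factor 8 combines the two cells of a vertex
    ([load_le]) with the quarter of [card_window]. *)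
Lemma stage1_load (T : nat) (A : {set Lab * V * L.-tuple V}) :
  (forall a, a \in A -> [/\ nice X J a.1.1, inrange a.1.1, lchain a.1.1 a.1.2 a.2 &
     T <= load a.1.1 a.1.2 a.2]) ->
  #|A| * ((T - 2 * (L * N)) %/ 8 - L * N) ^ L * N ^ (n - L) <=
    N ^ n * N ^ n * n * (B ^ 2 * 3 ^ (L.*2 + L)) * L`!.
Proof.
move=> HA; pose U (a : Lab * V * L.-tuple V) := spare a.1.1 a.1.2 a.2.
pose win (a : Lab * V * L.-tuple V) := window a.1.1 a.1.2 a.2.
apply: (@stage1 n N e esym eirr v0 X J X0 NE L L A U win) => [a|a h v|a] /HA[a1 a2 a3 a4] //.
  exact: spare_hit.
have := load_le a3 a2; rewrite size_tuple => le.
have le2 : \sum_(v in spare a.1.1 a.1.2 a.2) grid (topcell a.1.1 a.1.2 a.2 v) <=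
    4 * \sum_(v in spare a.1.1 a.1.2 a.2) #|window a.1.1 a.1.2 a.2 v|.
  by rewrite big_distrr /=; apply: leq_sum => v _; apply: card_window.
apply: leq_trans (_ : (8 * \sum_(v in spare a.1.1 a.1.2 a.2) #|window a.1.1 a.1.2 a.2 v|) %/ 8 <= _).
  by apply: leq_div2r; lia.
by rewrite mulKn.
Qed.

End Cells.

(** * Labels and permutations *)

Section Reach.
Variables (N R X J : nat).
Hypotheses (R0 : 0 < R) (XR : 2 * R <= X) (NE : N = 2 ^ J * X).
Notation grid := (grid N R X).

Let XN : X <= N. Proof. by rewrite NE leq_pmull // expn_gt0. Qed.

Lemma grid_advance g k m :
  (forall i, i < k -> m <= minn (grid (g + i)) (N - grid (g + i))) ->
  grid g + k * (m %/ (2 * R)) <= grid (g + k).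
Proof.
elim: k => [|k IH] H; first by rewrite mul0n !addn0.
rewrite addnS gridS mulSn addnCA addnC leq_add //; last by apply: leq_div2r; apply: H.
by apply: IH => i ik; apply: H; apply: ltnW.
Qed.

Lemma grid_advance4 g m : 2 * R <= m ->
  (forall i, i < 4 * R -> m <= minn (grid (g + i)) (N - grid (g + i))) ->
  grid g + m <= grid (g + 4 * R).
Proof.
move=> mR /grid_advance; apply: leq_trans; rewrite leq_add2l.
have := ltn_ceil m (_ : 0 < 2 * R); have : 0 < m %/ (2 * R) by rewrite divn_gt0 // muln_gt0.
move: (_ %/ _) => q q0 /(_ _); rewrite muln_gt0 R0 => /(_ isT); nia.
Qed.

(** In the lower half of the range, [4 * R] cells double the label; rounding costs a factor 2
    compared with [2 * R]. *)
Lemma grid_phase1 j : minn (2 ^ j * X) N <= 2 * grid (4 * R * j).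
Proof.
have gN := grid_le R XN.
elim: j => [|j IH]; first by rewrite muln0 expn0 /=; lia.
rewrite mulnS addnC; set g := 4 * R * j in IH *.
rewrite leqNgt; apply/negP => lt.
have small i : i <= 4 * R -> 2 * grid (g + i) < N.
  by move=> le; have := @grid_mono N R X (g + i) (g + 4 * R); rewrite leq_add2l le => /(_ isT); lia.
have xg := grid_ge N R X g.
have := @grid_advance4 g (grid g) (leq_trans XR xg).
have H i : i < 4 * R -> grid g <= minn (grid (g + i)) (N - grid (g + i)).
  move=> lti; have := small i (ltnW lti).
  by have := @grid_mono N R X g (g + i) (leq_addr _ _); lia.
move=> /(_ H) le; have s0 := small 0 isT; rewrite addn0 in s0.
by move: lt IH; rewrite expnS; lia.
Qed.

(** In the upper half, [4 * R] cells halve the distance to [N], until it is at most [X]. *)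
Lemma grid_phase2 j : 2 ^ j * (N - grid (4 * R * J + 4 * R * j)) <= N \/
  N - grid (4 * R * J + 4 * R * j) <= X.
Proof.
have gN := grid_le R XN.
elim: j => [|j IH]; first by left; rewrite expn0 mul1n leq_subr.
rewrite mulnS [4 * R + _]addnC addnA; set g := 4 * R * J + 4 * R * j in IH *.
have mono := @grid_mono N R X g (g + 4 * R) (leq_addr _ _).
have [le|lt] := leqP (N - grid (g + 4 * R)) X; [by right|left].
case: IH => IH; last by lia.
have half : N <= 2 * grid g.
  have := grid_phase1 J; rewrite NE minnn -NE => h; apply: leq_trans h _.
  by rewrite leq_mul2l; apply: grid_mono; apply: leq_addr.
have H i : i < 4 * R -> N - grid (g + 4 * R) <= minn (grid (g + i)) (N - grid (g + i)).
  move=> lti; have := @grid_mono N R X (g + i) (g + 4 * R); rewrite leq_add2l ltnW // => /(_ isT).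
  by have := @grid_mono N R X g (g + i) (leq_addr _ _); lia.
have := grid_advance4 (leq_trans XR (ltnW lt)) H; have := gN (g + 4 * R).
by move: IH; rewrite expnS; move: (2 ^ j) (grid _) (grid _) => p a b; nia.
Qed.

Lemma grid_reach : N - X <= grid (8 * R * J).
Proof.
have -> : 8 * R * J = 4 * R * J + 4 * R * J by lia.
case: (grid_phase2 J) => [|]; last by lia.
by rewrite [X in _ <= X -> _]NE leq_mul2l expn_eq0 /=; lia.
Qed.

End Reach.

(** * Union bounds and the passage from labellings to permutations *)

Section LabelCounts.
Variables (n N : nat).
Local Notation V := 'I_n.
Local Notation Lab := {ffun V -> 'I_N}.
Implicit Types (f : Lab).

Lemma card_label1 (v : V) (P : pred 'I_N) : #|[set f : Lab | P (f v)]| * N = #|P| * N ^ n.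
Proof.
have := card_windows (fun _ => P) (isT : uniq [:: v]).
rewrite big_cons big_nil muln1 /= => E.
have -> : [set f : Lab | P (f v)] = [set f : Lab | P (f v) && true].
  by apply/setP => f; rewrite !inE andbT.
rewrite E -mulnA -expnSr subn1 prednK //; exact: leq_trans (ltn_ord v).
Qed.

Lemma card_label2 (u v : V) (r : rel 'I_N) k : u != v -> (forall s, #|r s| <= k) ->
  #|[set f : Lab | r (f u) (f v)]| * N <= k * N ^ n.
Proof.
move=> nuv rk; have uq : uniq [:: u; v] by rewrite /= inE nuv.
have n2 : 1 < n by have := max_card [set u; v]; rewrite cards2 nuv card_ord.
pose P s w : pred 'I_N := if w == u then fun t => t == s else r s.
have le : #|[set f : Lab | r (f u) (f v)]| <= \sum_(s : 'I_N) k * N ^ (n - 2).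
  apply: leq_trans (_ : \sum_(s : 'I_N) #|[set f : Lab | all (fun w => P s w (f w)) [:: u; v]]| <= _).
    rewrite -sum1_card (partition_big (fun f : Lab => f u) predT) //=.
    apply: leq_sum => s _; rewrite sum1dep_card; apply: subset_leq_card; apply/subsetP => f.
    rewrite !inE /P eqxx [v == u]eq_sym (negbTE nuv) => /andP[ruv /eqP E].
    by rewrite /= E eqxx -E ruv.
  apply: leq_sum => s _; rewrite (card_windows (P s) uq) !big_cons big_nil muln1 leq_mul2r.
  rewrite /P eqxx [v == u]eq_sym (negbTE nuv) (eq_card (B := pred1 s)) // card1 mul1n.
  by rewrite rk orbT.
apply: leq_trans (leq_mul le (leqnn N)) _; rewrite sum_nat_const card_ord.
have -> : N * (k * N ^ (n - 2)) * N = k * (N ^ (n - 2) * N * N) by lia.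
by rewrite -!expnSr -subSn // -subSn ?subSS ?subn0 //; lia.
Qed.

Definition below f v : {set V} := [set u | f u < f v].

Lemma below_lt f v : #|below f v| < n.
Proof.
rewrite -[X in _ < X]card_ord -cardsT; apply: proper_card.
by apply/properP; split; [exact: subsetT|exists v; rewrite !inE ?ltnn].
Qed.

Definition rank f v : V := Ordinal (below_lt f v).

Lemma rank_lt f u v : (rank f u < rank f v) = (f u < f v).
Proof.
have sub a b : f a <= f b -> rank f a <= rank f b.
  move=> le; apply: subset_leq_card; apply/subsetP => w; rewrite !inE => lt; exact: leq_trans lt le.
have [lt|le] := ltnP (f u) (f v); last by rewrite ltnNge sub.
apply: proper_card; apply/properP; split.
  by apply/subsetP => w; rewrite !inE => /ltn_trans; apply.
by exists u; rewrite !inE ?ltnn.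
Qed.

Lemma rank_inj f : injective f -> injective (rank f).
Proof.
move=> fI u v E; apply: fI; apply/val_inj.
by case: (ltngtP (f u) (f v)) => // lt; move: (lt); rewrite -rank_lt E ltnn.
Qed.

Definition rankp f : {perm V} :=
  if injectiveP f is ReflectT fI then perm (rank_inj fI) else 1%g.

Lemma rankpE f v : injective f -> rankp f v = rank f v.
Proof. by move=> fI; rewrite /rankp; case: injectiveP => // ?; rewrite permE. Qed.

Definition injlabels : {set Lab} := [set f : Lab | injectiveb f].

Definition relabel (s : {perm V}) f : Lab := [ffun v => f (s v)].

Lemma relabel_inj s : injective (relabel s).
Proof.
move=> f g /ffunP E; apply/ffunP => v; have := E (s^-1 v)%g.
by rewrite !ffunE permKV.
Qed.

Lemma relabel_rank s f : injective f ->
  injective (relabel s f) /\ rankp (relabel s f) = (s * rankp f)%g.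
Proof.
move=> fI; have gI : injective (relabel s f) by move=> u v; rewrite !ffunE => /fI/perm_inj.
split=> //; apply/permP => v; rewrite permM !rankpE //; apply: val_inj => /=.
rewrite -(card_imset _ (@perm_inj _ s)); apply: eq_card => w.
apply/imsetP/idP => [[u]|]; first by rewrite in_set !ffunE => lt ->; rewrite in_set.
by rewrite in_set => lt; exists (s^-1 w)%g; rewrite ?permKV // in_set !ffunE permKV.
Qed.

(** Permuting the vertices acts on the injective labellings and translates [rankp], so all
    permutations are equally likely. *)
Lemma card_rank_class s :
  #|[set f in injlabels | rankp f == s]| = #|[set f in injlabels | rankp f == 1%g]|.
Proof.
apply/eqP; rewrite eqn_leq; apply/andP; split.
  rewrite -(card_imset _ (@relabel_inj s^-1%g)); apply: subset_leq_card.
  apply/subsetP => _ /imsetP[f fin ->]; move: fin; rewrite !inE => /andP[/injectiveP fI /eqP E].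
  have [gI ->] := relabel_rank s^-1%g fI; rewrite E mulVg eqxx andbT; exact/injectiveP.
rewrite -(card_imset _ (@relabel_inj s)); apply: subset_leq_card.
apply/subsetP => _ /imsetP[f fin ->]; move: fin; rewrite !inE => /andP[/injectiveP fI /eqP E].
have [gI ->] := relabel_rank s fI; rewrite E mulg1 eqxx andbT; exact/injectiveP.
Qed.

Lemma card_rank_in (B : {set {perm V}}) :
  #|[set f in injlabels | rankp f \in B]| = #|B| * #|[set f in injlabels | rankp f == 1%g]|.
Proof.
rewrite -sum_nat_const -sum1_card (partition_big rankp (mem B)) /=; last first.
  by move=> f; rewrite inE => /andP[].
apply: eq_bigr => s sB; rewrite -(card_rank_class s) sum1dep_card; apply: eq_card => f.
by rewrite !inE; case: eqP => [->|]; rewrite ?sB ?andbT ?andbF.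
Qed.

Hypothesis n0 : 0 < n.

Lemma card_injlabels : 2 * n ^ 2 <= N -> N ^ n <= 2 * #|injlabels|.
Proof.
move=> le; have N0 : 0 < N by apply: leq_trans le; rewrite muln_gt0 expn_gt0 n0.
have nonI : #|~: injlabels| * N <= n ^ 2 * N ^ n.
  apply: leq_trans (_ : (\sum_(p : V * V) #|[set f : Lab | (p.1 != p.2) && (f p.1 == f p.2)]|) * N <= _).
    rewrite leq_mul2r; apply/orP; right; rewrite -sum1_card.
    rewrite [X in _ <= X](eq_bigr (fun p : V * V => \sum_(f : Lab) ((p.1 != p.2) && (f p.1 == f p.2) : nat))); last first.
      by move=> p _; rewrite -sum1_card big_mkcond /=; apply: eq_bigr => f _; rewrite inE; case: (_ && _).
    rewrite exchange_big /= big_mkcond /=; apply: leq_sum => f _; rewrite !inE.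
    case: injectiveP => //= fN.
    have /injectivePn[u [v nuv E]] : ~~ injectiveb f by apply/injectiveP.
    by rewrite (bigD1 (u, v)) //= nuv E eqxx.
  rewrite big_distrl /=; apply: leq_trans (_ : \sum_(p : V * V) 1 * N ^ n <= _).
    apply: leq_sum => -[u v] _ /=; case: (boolP (u == v)) => nuv /=; last first.
      apply: card_label2 => // s; rewrite (eq_card (B := pred1 s)) ?card1 // => t.
      by rewrite !inE eq_sym.
    by rewrite (_ : [set _ | _] = set0) ?cards0 //; apply/setP => f; rewrite !inE.
  by rewrite sum_nat_const card_prod !card_ord mul1n mulnn.
have := cardsC injlabels; rewrite card_ffun !card_ord => E.
have h : 2 * #|~: injlabels| <= N ^ n.
  rewrite -(leq_pmul2r N0) -mulnA; apply: leq_trans (leq_mul (leqnn 2) nonI) _.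
  by rewrite mulnA mulnC leq_mul2l le orbT.
lia.
Qed.

(** Given injectivity the rank permutation is uniform, and conditioning on injectivity costs the
    factor 2. The inverse appears because an order maps positions to vertices while [rankp] maps
    vertices to positions. *)
Lemma perm_bound (P : pred {perm V}) (Q : pred Lab) (M K : nat) : 2 * n ^ 2 <= N ->
  (forall f, injective f -> P (rankp f)^-1%g -> Q f) ->
  #|[set f in injlabels | Q f]| * M <= K * N ^ n ->
  #|[set s | P s]| * M <= 2 * K * n`!.
Proof.
move=> le PQ cQ; set c := #|[set f in injlabels | rankp f == 1%g]|.
pose B := [set s : {perm V} | P s^-1%g].
have cB : #|[set s | P s]| = #|B|.
  rewrite -(card_imset _ (@invg_inj _)); apply: eq_card => s.
  apply/imsetP/idP => [[t]|]; first by rewrite in_set => Pt ->; rewrite in_set invgK.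
  by rewrite in_set => Ps; exists s^-1%g; rewrite ?invgK ?in_set.
have inj := card_injlabels le.
have all : #|injlabels| = n`! * c.
  rewrite /c -(card_Sn n) -cardsT -card_rank_in; apply: eq_card => f.
  by rewrite !inE andbT.
have bc : #|B| * c <= #|[set f in injlabels | Q f]|.
  rewrite -card_rank_in; apply: subset_leq_card; apply/subsetP => f.
  by rewrite !inE => /andP[fI Pf]; rewrite fI; apply: PQ => //; apply/injectiveP.
have N0 : 0 < N ^ n.
  by rewrite expn_gt0 (leq_trans _ le) // muln_gt0 expn_gt0 n0.
have c0 : 0 < c by move: all inj; case: (c) => //; rewrite muln0 => ->; lia.
rewrite cB -(leq_pmul2r c0).
have -> : #|B| * M * c = #|B| * c * M by lia.
apply: leq_trans (leq_mul bc (leqnn M)) (leq_trans cQ _).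
have -> : 2 * K * n`! * c = K * (2 * #|injlabels|) by rewrite all; lia.
by rewrite leq_mul2l inj orbT.
Qed.

End LabelCounts.

(** * Resampling *)

Lemma first_killer_ext (T : finType) (e : rel T) (p q : T -> nat) d K :
  mis e p = mis e q -> {in mis e p, p =1 q} ->
  first_killer e d p K = first_killer e d q K.
Proof.
move=> EM E; rewrite /first_killer; congr odflt; apply: eq_pick => z /=.
rewrite -EM; case: (boolP (z \in mis e p)) => //= zM; congr (_ && _).
apply/forall_inP/forall_inP => H w wM; have := H w wM; by rewrite !E.
Qed.

Section Stage2.
Variables (n N : nat) (e : rel 'I_n).
Hypotheses (esym : symmetric e) (eirr : irreflexive e).
Local Notation V := 'I_n.
Local Notation Lab := {ffun V -> 'I_N}.
Notation Mis f := (mis e (key f)).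
Notation lkiller := (lkiller e).
Notation trans := (trans e).
Notation lchain := (lchain e).
Variables (X J R Jf : nat).
Hypotheses (X1 : 1 < X) (R0 : 0 < R) (NE : N = 2 ^ J * X).
Notation grid := (grid N R X).
Notation cell := (cell N R X Jf).
Notation tcell := (tcell e X R Jf).
Notation tpend := (tpend e X R Jf).
Notation pend := (pend e X R).
Notation inrange := (inrange X R Jf).
Implicit Types (f h : Lab) (u v w z : V) (us : seq V) (x : V * V).

(** Only MIS labels are restricted, so that the condition survives the resampling of the [u_i]. *)
Definition inrangeM f := [forall w in Mis f, (X <= f w) && (f w < grid Jf)].

(* A dependency path without the upper bounds on the labels of the [u_i]. *)
Fixpoint wchain f z us :=
  (z \in Mis f) && (if us is u :: us' then
    [&& e u z, f (lkiller f u) < f u, f (lkiller f u) < f z & wchain f (lkiller f u) us'] else true).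

(** [nfree] counts the labels above that of [m_i], and [gap] those strictly between [m_i] and
    [m_{i+1}]; so [gap / nfree] is the probability that a resampled [u_i] falls between them. *)
Definition nfree f x := N - (f (lkiller f x.2)).+1.
Definition gap f x := f x.1 - (f (lkiller f x.2)).+1.
Definition dcell f x := cell (f x.1) - tcell f x.

Definition swp us f h : Lab := [ffun v => if v \in us then h v else f v].

Lemma swpK us f h : swp us (swp us f h) (swp us h f) = f.
Proof. by apply/ffunP => v; rewrite !ffunE; case: (v \in us). Qed.

Lemma trans_us f z us : [seq x.2 | x <- trans f z us] = us.
Proof. by elim: us z => //= u us IH z; rewrite IH. Qed.

Section Swap.
Variables (f h : Lab) (z : V) (us : seq V).
Hypotheses (ch : lchain f z us) (hh : all (fun u => f (lkiller f u) < h u) us).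
Let f' := swp us f h.

Lemma us_notin u : u \in us -> u \notin Mis f.
Proof.
rewrite -{1}(trans_us f z us) => /mapP[x xin ->].
by have [[]] := trans_chain esym eirr ch xin.
Qed.

Lemma swp_on_mis w : w \in Mis f -> f' w = f w.
Proof. by move=> wM; rewrite ffunE; case: ifP => // /us_notin; rewrite wM. Qed.

Lemma key_swp_mis w : w \in Mis f -> key f' w = key f w.
Proof. by move=> wM; rewrite /key swp_on_mis. Qed.

(** Each [u] keeps a label above its killer and stays outside the MIS; the other vertices keep their
    labels and see the same MIS labels. *)
Lemma mis_swp : Mis f' = Mis f.
Proof.
apply: mis_unique => v; have [vu|vu] := boolP (v \in us).
  have vM := us_notin vu; rewrite (negbTE vM); symmetry; apply/negbTE.
  have [mM emv lt _] := killerP vM.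
  rewrite negb_forall_in; apply/exists_inP; exists (lkiller f v) => //.
  rewrite negb_imply emv /= -ltnNge key_swp_mis //; apply: keyv_lt.
  by rewrite ffunE vu; apply: (allP hh).
rewrite mis_greedy; apply: eq_forallb => u; case: (boolP (u \in Mis f)) => //= uM.
have -> : key f' v = key f v by rewrite /key [f' v]ffunE (negbTE vu).
by rewrite key_swp_mis.
Qed.

Lemma lkiller_swp u : lkiller f' u = lkiller f u.
Proof.
apply: first_killer_ext; rewrite mis_swp // => w wM; exact: key_swp_mis.
Qed.

Lemma trans_swp z' us' : trans f' z' us' = trans f z' us'.
Proof. by elim: us' z' => //= u us' IH z'; rewrite lkiller_swp IH. Qed.

Lemma swp_trans x : x \in trans f z us ->
  [/\ f' x.1 = f x.1, f' (lkiller f' x.2) = f (lkiller f x.2) & f' x.2 = h x.2].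
Proof.
move=> xin; have [[uM zM _ _ _] xu] := trans_chain esym eirr ch xin.
have [mM _ _ _] := killerP uM.
by rewrite lkiller_swp (swp_on_mis zM) (swp_on_mis mM) /f' ffunE xu.
Qed.

Lemma wchain_swp : wchain f' z us.
Proof.
suff gen us' z' : lchain f z' us' -> {subset us' <= us} -> wchain f' z' us' by apply: gen.
elim: us' z' => [|u us' IH] z'; first by move=> /lchain_mis zM _ /=; rewrite mis_swp zM.
move=> ch' sub; rewrite /= mis_swp (lchain_mis ch') lkiller_swp.
have [euz l1 l2 l3 ch''] := lchain_lab ch'.
have uu : u \in us by apply: sub; rewrite mem_head.
have [mM _ _ _] := killerP (us_notin uu).
rewrite euz (swp_on_mis (lchain_mis ch')) (swp_on_mis mM) l3 /f' ffunE uu (allP hh) //=.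
by apply: IH => // y yin; apply: sub; rewrite in_cons yin orbT.
Qed.

Lemma pend_swp z' g : pend f' z' g = pend f z' g.
Proof.
apply/setP => v; rewrite !in_set; congr (_ && _).
rewrite mis_swp; apply/forall_inP/forall_inP => H w wM; have := H w wM; by rewrite swp_on_mis.
Qed.

End Swap.

Local Open Scope ring_scope.

(** Weights for walking the path backwards: [1 / |D_i|] pays for the choice of [u_i], the power of 2
    for the choice of the cell of [m_i]. *)
Definition wt f x : rat := (#|tpend f x|)%:R^-1 * 2 ^- dcell f x.

Lemma wt_ge0 f x : 0 <= wt f x.
Proof. by rewrite /wt mulr_ge0 // invr_ge0 // exprn_ge0. Qed.

Lemma wt_swp f h z us x : lchain f z us -> all (fun u => f (lkiller f u) < h u)%N us ->
  x \in trans f z us ->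
  wt (swp us f h) x = wt f x /\ gap (swp us f h) x = gap f x.
Proof.
move=> ch hh xin; have [E1 E2 _] := swp_trans ch hh xin.
by rewrite /wt /gap /dcell /tpend /tcell !E1 !E2 (pend_swp ch hh).
Qed.

Lemma cell_sum c (F : nat -> rat) : (forall g, F g <= 1) -> 
  \sum_(g < c.+1) (2 ^- (c - g)) * F g <= 2.
Proof.
move=> F1; apply: (@le_trans _ _ (\sum_(g < c.+1) (2 ^- (c - g)) : rat)).
  apply: ler_sum => g _; rewrite ler_piMr // invr_ge0 exprn_ge0 //.
rewrite (reindex_inj rev_ord_inj) /=.
rewrite (eq_bigr (fun g : 'I_c.+1 => (2^-1 : rat) ^+ g)); last first.
  by move=> g _; rewrite subSS subKn ?exprVn // -ltnS.
elim: c {F F1} => [|c IH]; first by rewrite big_ord1 expr0.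
rewrite big_ord_recl expr0 (eq_bigr (fun i : 'I_c.+1 => 2^-1 * (2^-1 : rat) ^+ i)); last first.
  by move=> i _; rewrite -exprS.
by rewrite -big_distrr /=; lra.
Qed.

(** Group the [u] by the cell [g] of their killer; they lie in [pend f z g], as their first MIS
    neighbour is not before [grid g]. Cell [g] contributes at most [2 ^- (c - g)], a geometric
    series. *)
Lemma sum_step f z : inrangeM f -> z \in Mis f ->
  \sum_(u | [&& e u z, (f (lkiller f u) < f u)%N & (f (lkiller f u) < f z)%N]) wt f (z, u) <= 2.
Proof.
move=> /forall_inP rg zM; pose c := cell (f z).
pose F g : rat := \sum_(u in pend f z g) (#|pend f z g|)%:R^-1.
have F1 g : F g <= 1.
  rewrite /F sumr_const -[X in X <= _]mulr_natl.
  case: (posnP #|pend f z g|) => [->|gt]; first by rewrite mul0r.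
  by rewrite mulfV // pnatr_eq0 -lt0n.
apply: le_trans (cell_sum c F1).
rewrite (eq_bigr (fun g : 'I_c.+1 => \sum_(u in pend f z g) 2 ^- (c - g) * (#|pend f z g|)%:R^-1)); last first.
  by move=> g _; rewrite big_distrr.
rewrite (exchange_big_dep predT) //= big_mkcond /=; apply: ler_sum => u _.
have ge0 (P : pred 'I_c.+1) : 0 <= \sum_(g < c.+1 | P g) (2 ^- (c - g) * (#|pend f z g|)%:R^-1 : rat).
  by apply: sumr_ge0 => g _; rewrite mulr_ge0 // invr_ge0 // exprn_ge0.
case: ifP => // /and3P[euz l1 l2].
have uM : u \notin Mis f.
  by apply/negP => uM; have := mis_indep esym eirr (@key_inj _ _ f) uM zM; rewrite euz.
have [mM _ _ mz] := killerP uM.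
have gc : (tcell f (z, u) < c.+1)%N by rewrite ltnS; apply: cell_mono; apply: ltnW.
rewrite (bigD1 (Ordinal gc)) /=; last first.
  rewrite in_set euz /=; apply/forall_inP => w wM; apply/implyP => ewu.
  have [_ c1 _] := cellP (rg _ mM).
  exact: leq_trans c1 (keyv_lt_le' (mz w wM ewu)).
by rewrite /wt mulrC lerDl; apply: ge0.
Qed.

Lemma sum_wchain f z L : inrangeM f ->
  \sum_(us : L.-tuple V | wchain f z us) \prod_(x <- trans f z us) wt f x <= 2 ^+ L.
Proof.
move=> rg; elim: L z => [|L IH] z.
  rewrite expr0 big_mkcond (big_pred1 [tuple]) /=; last by move=> t; symmetry; apply/eqP; exact: tuple0.
  by case: ifP => // _; rewrite big_nil.
rewrite big_mkcond big_tuple_cons exprS /=.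
case: (boolP (z \in Mis f)) => zM; last by rewrite big1 ?mulr_ge0 ?exprn_ge0 // => u _; rewrite big1.
apply: (@le_trans _ _ (\sum_(u | [&& e u z, (f (lkiller f u) < f u)%N & (f (lkiller f u) < f z)%N]) wt f (z, u) * 2 ^+ L)).
  rewrite [X in _ <= X]big_mkcond /=; apply: ler_sum => u _.
  case: (boolP [&& _, _ & _]) => [/and3P[-> -> ->]|nc] /=; last first.
    rewrite big1 // => us _; case: ifP => // H; case/negP: nc.
    by case/and4P: H => -> -> ->.
  rewrite -big_mkcond /=; apply: le_trans (ler_wpM2l (wt_ge0 _ _) (IH (lkiller f u))).
  by rewrite big_distrr /=; apply: ler_sum => us _; rewrite big_cons.
by rewrite -big_distrl /= ler_wpM2r ?exprn_ge0 // sum_step.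
Qed.

Lemma card_interval a b : (b <= N)%N -> #|[pred t : 'I_N | (a < t)%N && (t < b)%N]| = (b - a.+1)%N.
Proof.
move=> bN; have ip (i : 'I_(b - a.+1)) : (a.+1 + i < N)%N by have := ltn_ord i; lia.
have inj : injective (fun i : 'I_(b - a.+1) => Ordinal (ip i)).
  by move=> i j [] /addnI/val_inj.
rewrite -[RHS]card_ord -(card_codom inj); apply: eq_card => t; rewrite inE /=.
apply/idP/codomP => [/andP[l1 l2]|[i ->]] /=; last by have := ltn_ord i; lia.
have l : (t - a.+1 < b - a.+1)%N by lia.
by exists (Ordinal l); apply: val_inj => /=; lia.
Qed.

Lemma lchain_us f z us : lchain f z us -> uniq us /\ forall u, u \in us -> (f u < f z)%N.
Proof.
elim: us z => [//|u us IH] z ch; have [_ l1 l2 _ ch'] := lchain_lab ch.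
have [uq lt] := IH _ ch'; rewrite /= uq andbT; split.
  by apply/negP => /lt; lia.
by move=> w; rewrite in_cons => /orP[/eqP->//|/lt]; lia.
Qed.

Definition slack f x : rat := (nfree f x)%:R / (gap f x)%:R.

(* Exchanging the values of [f] and of an independent labelling [h] on the [u_i]
   is an involution that leaves the MIS unchanged. *)
Lemma swap_sum z us :
  \sum_(f | lchain f z us && inrangeM f) \prod_(x <- trans f z us) (slack f x * wt f x) <=
  \sum_(f | wchain f z us && inrangeM f) \prod_(x <- trans f z us) wt f x.
Proof.
case: (boolP (uniq us)) => [uq|nuq]; last first.
  rewrite big_pred0 => [|f]; last first.
    by apply/negP => /andP[/lchain_us[uq _]]; rewrite uq in nuq.
  apply: sumr_ge0 => f _; apply: prodr_ge0 => x _; exact: wt_ge0.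
have N0 : (0 < N)%N by rewrite NE muln_gt0 expn_gt0 (ltnW X1).
pose Nf : rat := (N ^ (n - size us))%N%:R.
have Nf0 : 0 < Nf by rewrite ltr0n expn_gt0 N0.
rewrite -(ler_pM2r Nf0) !big_distrl /=.
pose psi f := \prod_(x <- trans f z us) (wt f x / (gap f x)%:R) : rat.
pose after f h := all (fun u => f (lkiller f u) < h u)%N us.
pose inside f u (t : 'I_N) := has (fun x => (x.2 == u) && ((f (lkiller f u) < t)%N && (t < f x.1)%N)) (trans f z us).
have psi0 f : 0 <= psi f.
  by apply: prodr_ge0 => x _; rewrite mulr_ge0 ?wt_ge0 // invr_ge0.
have prod_us (R' : comNzRingType) f (F : V -> R') : \prod_(u <- us) F u = \prod_(x <- trans f z us) F x.2.
  by rewrite -{1}(trans_us f z us) big_map.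
(* The factors [nfree] of [slack] count, up to [N ^ (n - size us)], the labellings [h] allowed by
   [after]; what is left of the summand is [psi]. *)
apply: (@le_trans _ _ (\sum_(p : Lab * Lab | lchain p.1 z us && inrangeM p.1 && after p.1 p.2) psi p.1)).
  rewrite -(pair_big_dep (fun f => lchain f z us && inrangeM f) (fun f h => after f h) (fun f h => psi f)) /=.
  apply: ler_sum => f _; rewrite sumr_const -[X in _ <= X]mulr_natr.
  rewrite (_ : #|_| = \prod_(u <- us) #|[pred t : 'I_N | (f (lkiller f u) < t)%N]| * N ^ (n - size us))%N; last first.
    by rewrite -(card_windows (fun u => [pred t : 'I_N | (f (lkiller f u) < t)%N]) uq) cardsE.
  rewrite natrM mulrA ler_wpM2r ?(ltW Nf0) // natr_prod (prod_us _ f) -big_split /=.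
  rewrite le_eqVlt; apply/orP; left; apply/eqP; apply: eq_bigr => x _.
  rewrite (_ : #|_| = nfree f x); first by rewrite /slack; ring.
  rewrite /nfree -(card_interval (f (lkiller f x.2)) (leqnn N)); apply: eq_card => t.
  by rewrite !inE ltn_ord andbT.
(* Exchanging the values on [us] maps the pairs with [lchain] and [after] to pairs with [wchain] and
   [inside], without changing [psi]. *)
apply: (@le_trans _ _ (\sum_(p : Lab * Lab | wchain p.1 z us && inrangeM p.1 && all (fun u => inside p.1 u (p.2 u)) us) psi p.1)).
  pose sw (p : Lab * Lab) := (swp us p.1 p.2, swp us p.2 p.1).
  have swK : cancel sw sw by move=> [f h]; rewrite /sw /= !swpK.
  rewrite [X in _ <= X](reindex_inj (can_inj swK)) /=.
  rewrite big_mkcond [X in _ <= X]big_mkcond /=; apply: ler_sum => -[f h] _ /=.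
  case: ifP => [/andP[/andP[ch rg] hh]|_]; last by case: ifP.
  rewrite (wchain_swp ch hh) /=.
  have -> : inrangeM (swp us f h).
    rewrite /inrangeM (mis_swp ch hh); apply/forall_inP => w wM.
    by rewrite (swp_on_mis h ch wM); apply: (forall_inP rg).
  have -> : all (fun u => inside (swp us f h) u (swp us h f u)) us.
    apply/allP => u; rewrite -{1}(trans_us f z us) => /mapP[x xin ->].
    apply/hasP; exists x; first by rewrite (trans_swp ch hh).
    have [E1 E2 _] := swp_trans ch hh xin.
    have [[_ _ l1 l2 _] xu] := trans_chain esym eirr ch xin.
    by rewrite eqxx E1 E2 ffunE xu l1 l2.
  rewrite /psi (trans_swp ch hh) le_eqVlt; apply/orP; left; apply/eqP.
  apply: eq_big_seq => x xin; have [-> ->] := wt_swp ch hh xin; by [].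
rewrite -(pair_big_dep (fun f => wchain f z us && inrangeM f)
  (fun f h => all (fun u => inside f u (h u)) us) (fun f h => psi f)) /=.
apply: ler_sum => f _; rewrite sumr_const -[X in X <= _]mulr_natr.
rewrite (_ : #|_| = \prod_(u <- us) #|inside f u| * N ^ (n - size us))%N; last first.
  by rewrite -(card_windows (inside f) uq) cardsE.
rewrite natrM mulrA ler_wpM2r ?(ltW Nf0) // natr_prod (prod_us _ f) -big_split /= big_seq [X in _ <= X]big_seq.
apply: ler_prod => x xin; apply/andP; split.
  by apply: mulr_ge0 => //; apply: mulr_ge0 => //; rewrite ?wt_ge0 ?invr_ge0.
(* At most [gap] values of [h] are now allowed at each [u], which cancels the factor [1 / gap] of
   [psi]; if [gap] vanishes the term is 0. *)
have cl : (#|inside f x.2| <= gap f x)%N.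
  rewrite /gap -card_interval ?(ltnW (ltn_ord _)) //; apply: subset_leq_card.
  apply/subsetP => t; rewrite inE => /hasP[y yin /andP[/eqP E lt]] /=.
  suff -> : x = y by rewrite -{1}E in lt.
  have um : uniq [seq x.2 | x <- trans f z us] by rewrite trans_us.
  by apply: (uniq_map_inj um xin yin); rewrite E.
rewrite -mulrA ler_piMr ?wt_ge0 //.
case: (posnP (gap f x)) => [->|gt]; first by rewrite invr0 mul0r.
by rewrite mulrC ler_pdivrMr ?ltr0n // mul1r ler_nat.
Qed.

End Stage2.

Section AGM.
Local Open Scope ring_scope.

Lemma AGM_seq (F : realFieldType) (I : eqType) (s : seq I) (E : I -> F) : (forall x, 0 <= E x) ->
  \prod_(x <- s) E x <= ((\sum_(x <- s) E x) / (size s)%:R) ^+ size s.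
Proof.
move=> E0; rewrite [\prod_(_ <- _) _]big_tnth [\sum_(_ <- s) _]big_tnth.
have := (@leif_AGM F _ [pred i : 'I_(size s) | true] (fun i => E (tnth (in_tuple s) i))).
rewrite /= (eq_card (B := predT)) // card_ord => H.
by have [] := H (fun i _ => E0 _).
Qed.

End AGM.

(** * First moment bound for paths of small load *)

Section Stage2Count.
Local Open Scope ring_scope.
Variables (n N : nat) (e : rel 'I_n).
Hypotheses (esym : symmetric e) (eirr : irreflexive e).
Local Notation V := 'I_n.
Local Notation Lab := {ffun V -> 'I_N}.
Notation Mis f := (mis e (key f)).
Notation lkiller := (lkiller e).
Notation trans := (trans e).
Notation lchain := (lchain e).
Variables (X J R Jf : nat).
Hypotheses (X1 : (1 < X)%N) (R0 : (0 < R)%N) (NE : N = (2 ^ J * X)%N).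
Notation grid := (grid N R X).
Notation cell := (cell N R X Jf).
Notation tcell := (tcell e X R Jf).
Notation tpend := (tpend e X R Jf).
Notation inrange := (inrange X R Jf).
Notation nfree := (nfree e).
Notation gap := (gap e).
Notation dcell := (dcell e X R Jf).
Notation load := (load e X R Jf).
Notation wt := (wt e X R Jf).
Notation slack := (slack e).
Implicit Types (f h : Lab) (u v w z : V) (us : seq V) (x : V * V).

(** Markov's inequality for path weights: once [swap_sum] has removed [slack], the weights sum to at
    most [2 ^ L] for each [f] and [z] ([sum_wchain]). *)
Lemma card_le_sum (L : nat) (A : {set Lab * V * L.-tuple V}) (M : rat) : 0 <= M ->
  (forall a, a \in A -> [/\ inrange a.1.1, lchain a.1.1 a.1.2 a.2 &
     1 <= M * \prod_(x <- trans a.1.1 a.1.2 a.2) (slack a.1.1 x * wt a.1.1 x)]) ->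
  #|A|%:R <= M * (n%:R * (N ^ n)%:R * 2 ^+ L).
Proof.
move=> M0 HA.
pose P f z us := lchain f z us && inrangeM e X R Jf f.
pose W f z us := \prod_(x <- trans f z us) (slack f x * wt f x).
have W0 f z us : 0 <= W f z us.
  by apply: prodr_ge0 => x _; rewrite mulr_ge0 ?wt_ge0 // divr_ge0.
apply: (@le_trans _ _ (M * \sum_z \sum_(us : L.-tuple V) \sum_(f | P f z us) W f z us)).
  rewrite exchange_big /= pair_big /=.
  rewrite (eq_bigr (fun p : L.-tuple V * V => \sum_(f : Lab) if P f p.2 p.1 then W f p.2 p.1 else 0)); last first.
    by move=> p _; rewrite -big_mkcond.
  rewrite pair_big /= -sum1_card natr_sum big_distrr /= big_mkcond /=.
  rewrite (reindex (fun p : L.-tuple V * V * Lab => ((p.2, p.1.2), p.1.1))) /=; last first.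
    by exists (fun a : Lab * V * L.-tuple V => ((a.2, a.1.2), a.1.1)) => [[[]]|[[]]].
  apply: ler_sum => -[[us z] f] _ /=; case: ifP => [/HA[/= rg ch le]|_].
    rewrite ifT // /P ch /=; apply/forall_inP => w _; exact: rg.
  by apply: mulr_ge0 => //; case: ifP.
apply: ler_wpM2l => //.
apply: (@le_trans _ _ (\sum_z \sum_(f | inrangeM e X R Jf f) \sum_(us : L.-tuple V | wchain e f z us)
   \prod_(x <- trans f z us) wt f x)).
  apply: ler_sum => z _; rewrite [X in _ <= X](exchange_big_dep predT) //=.
  apply: (@le_trans _ _ (\sum_(us : L.-tuple V) \sum_(f | wchain e f z us && inrangeM e X R Jf f) \prod_(x <- trans f z us) wt f x)).
    by apply: ler_sum => us _; eapply swap_sum; eassumption.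
  rewrite le_eqVlt; apply/orP; left; apply/eqP; apply: eq_bigr => us _.
  by apply: eq_bigl => f; rewrite andbC.
apply: (@le_trans _ _ (\sum_(z : V) \sum_(f : Lab) 2 ^+ L)).
  apply: ler_sum => z _; rewrite big_mkcond; apply: ler_sum => f _ /=.
  by case: ifP => [rg|_]; [eapply sum_wchain; eassumption|rewrite exprn_ge0].
rewrite !sumr_const card_ffun !card_ord.
by rewrite -[X in X <= _]mulr_natl -[2 ^+ L *+ _]mulr_natl mulrA.
Qed.

(* [ghat] bounds [gap / nfree] up to the telescoping factors of [telescope]; at
   most one step of a path leaves a given cell. *)
Definition kappa g : rat := ((N - grid g.+1)%N%:R)^-1.
Definition ghat f x : rat :=
  if dcell f x == 0%N then (gap f x)%:R * kappa (tcell f x)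
  else (grid (tcell f x))%:R / (R * N)%N%:R.

Lemma ghat_ge0 f x : 0 <= ghat f x.
Proof. by rewrite /ghat; case: ifP => _; rewrite mulr_ge0 // invr_ge0. Qed.

Let N0 : (0 < N)%N. Proof. by rewrite NE muln_gt0 expn_gt0 (ltnW X1). Qed.

(** With [x = grid g], [y = N - x] and width [q]: [2 * R * q <= minn x y],
    [minn x y * (x + y) <= 2 * x * y] and [y <= 2 * (y - q)]. *)
Lemma grid_room g : (grid g < N)%N ->
  (grid g.+1 < N)%N /\ ((grid g.+1 - grid g) * (R * N) <= 2 * grid g * (N - grid g.+1))%N.
Proof.
move=> lt; rewrite gridS; set x := grid g in lt *.
have := leq_divM (minn x (N - x)) (2 * R).
have := geq_minl x (N - x); have := geq_minr x (N - x).
move: (minn _ _) => m; move: (m %/ _)%N => q h1 h2 h3.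
have [y E] : exists y, N = (x + y)%N by exists (N - x)%N; lia.
move: lt h1; rewrite E addKn => lt h1.
have a1 : (q * (2 * R) <= x)%N by lia.
have a2 : (q * (2 * R) <= y)%N by lia.
have y0 : (0 < y)%N by lia.
have q2 : (2 * q <= y)%N by nia.
split; first by nia.
rewrite addKn subnDl.
have a3 : (q * R * (x + y) <= x * y)%N.
  have [le|le] := leqP x y.
    by apply: (@leq_trans (q * R * (2 * y))%N); nia.
  by apply: (@leq_trans (q * R * (2 * x))%N); nia.
have a4 : (x * y <= 2 * x * (y - q))%N by rewrite -mulnA mulnCA leq_mul2l; apply/orP; right; lia.
by rewrite mulnA; apply: leq_trans a3 a4.
Qed.

Lemma kappa_le g : (grid g < N)%N ->
  (grid g.+1 - grid g)%N%:R * kappa g <= 2 * ((grid g)%:R / (R * N)%N%:R).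
Proof.
move=> /grid_room[lt le]; rewrite /kappa ler_pdivrMr ?ltr0n ?subn_gt0 //.
rewrite mulrA mulrAC ler_pdivlMr ?ltr0n ?muln_gt0 ?R0 //.
by rewrite -!natrM ler_nat.
Qed.

(* Inside a cell the gaps of a path add up to at most its width. *)
Lemma cell_ghat f z us g : lchain f z us -> inrange f ->
  \sum_(x <- trans f z us | tcell f x == g) ghat f x <=
  if (cell (f z) < g)%N then 0 else
  if cell (f z) == g then (f z - grid g)%N%:R * kappa g
  else 3 * ((grid g)%:R / (R * N)%N%:R).
Proof.
move=> ch rg.
have k0 : 0 <= kappa g by rewrite invr_ge0.
have w0 : 0 <= (grid g)%:R / (R * N)%N%:R :> rat by rewrite divr_ge0.
elim: us z ch => [|u us IH] z ch.
  rewrite big_nil; case: ifP => // _; case: ifP => _; last by lra.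
  by rewrite mulr_ge0.
have [_ l1 l2 l3 ch'] := lchain_lab ch; have {}IH := IH _ ch'.
have cm : (cell (f (lkiller f u)) <= cell (f z))%N by apply: cell_mono; apply: ltnW.
rewrite /= big_cons; have [_ m1 m2] := cellP (rg (lkiller f u)).
have [_ z1 z2] := cellP (rg z).
rewrite -[X in if X then _ else _]/(cell (f (lkiller f u)) == g).
move: IH; case: (ltngtP (cell (f (lkiller f u))) g) => [lt|gt|E] IH.
- apply: le_trans IH _; case: ifP => // _; case: ifP => _; last by lra.
  by rewrite mulr_ge0.
- by rewrite ltnNge (ltnW (leq_trans gt cm)) /= gtn_eqF // (leq_trans gt cm).
have gN : (grid g < N)%N by rewrite -E; apply: leq_ltn_trans m1 (ltn_ord _).
have kl2 := kappa_le gN.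
rewrite ltnNge -E cm /= /ghat /dcell /tcell /= E subn_eq0.
rewrite E in cm m1 m2.
case: (ltngtP (cell (f z)) g) cm => // [gt|Ez] _.
  (* The step leaving cell [g] contributes [grid g / (R * N)], and those before it inside the cell
     at most twice that; hence the constant 3. *)
  rewrite /=; apply: le_trans (lerD (lexx _) (le_trans IH (le_trans _ kl2))) _; last by lra.
  by rewrite ler_wpM2r // ler_nat leq_sub2r // ltnW.
rewrite /=; apply: le_trans (lerD (lexx _) IH) _.
rewrite -mulrDl ler_wpM2r // -natrD ler_nat /gap /=.
by move: m1 l3; move: (nat_of_ord _) (nat_of_ord _) (grid g) => a b c; lia.
Qed.

(** Within a cell each [tpend] is contained in [cellpend], whose size times the start of the cell is
    its part of the load. *)
Lemma sum_ghat f z us : lchain f z us -> inrange f ->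
  \sum_(x <- trans f z us) #|tpend f x|%:R * ghat f x <= 3 * (load f z us)%:R / (R * N)%N%:R.
Proof.
move=> ch rg.
have -> : \sum_(x <- trans f z us) #|tpend f x|%:R * ghat f x =
    \sum_(g < Jf) \sum_(x <- trans f z us | tcell f x == g) #|tpend f x|%:R * ghat f x.
  rewrite (exchange_big_dep predT) //=; apply: eq_bigr => x _.
  have [cl _ _] := cellP (rg (lkiller f x.2)).
  by rewrite (big_pred1 (Ordinal cl)) // => g; rewrite [RHS]eq_sym.
rewrite /load natr_sum big_distrr /= big_distrl /=; apply: ler_sum => g _.
apply: (@le_trans _ _ (#|cellpend e X R Jf f z us g|%:R * \sum_(x <- trans f z us | tcell f x == g) ghat f x)).
  rewrite big_distrr /= big_seq_cond [X in _ <= X]big_seq_cond.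
  apply: ler_sum => x /andP[xin /eqP xg]; rewrite ler_wpM2r ?ghat_ge0 // ler_nat.
  by apply: subset_leq_card; apply/subsetP => v vx; apply/cellpendP; exists x.
have -> (c d : nat) (r : rat) : 3 * (c * d)%N%:R / r = c%:R * (3 * (d%:R / r)) by rewrite natrM; ring.
apply: ler_wpM2l => //.
have [lt|ge] := ltnP (grid g) N; last first.
  rewrite big1_seq; first by rewrite mulr_ge0 // divr_ge0.
  move=> x /andP[/eqP xg _]; have [_ c _] := cellP (rg (lkiller f x.2)).
  by have := ltn_ord (f (lkiller f x.2)); rewrite ltnNge (leq_trans ge) // -xg.
apply: le_trans (cell_ghat g ch rg) _.
have w0 : 0 <= (grid g)%:R / (R * N)%N%:R :> rat by rewrite divr_ge0.
case: ifP => _; first by rewrite mulr_ge0.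
case: eqP => [E|_] //; have [_ z1 z2] := cellP (rg z); rewrite E in z1 z2.
apply: (@le_trans _ _ (2 * ((grid g)%:R / (R * N)%N%:R))); last by lra.
apply: le_trans (kappa_le lt); rewrite ler_wpM2r ?invr_ge0 // ler_nat.
by rewrite leq_sub2r // ltnW.
Qed.

Lemma telescope f z us : lchain f z us -> inrange f ->
  \prod_(x <- trans f z us) ((f x.1)%:R / (f (lkiller f x.2))%:R * (4 * R)%N%:R ^+ dcell f x) <=
  (f z)%:R / X%:R * (4 * R)%N%:R ^+ cell (f z) :> rat.
Proof.
move=> ch rg; have R1 : (1 : rat) <= (4 * R)%N%:R by rewrite ler1n muln_gt0.
elim: us z ch => [|u us IH] z ch.
  rewrite big_nil mulr_ege1 ?exprn_ege1 //.
  by rewrite ler_pdivlMr ?ltr0n ?(ltnW X1) // mul1r ler_nat; have /andP[] := rg z.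
have [_ l1 l2 l3 ch'] := lchain_lab ch; have {}IH := IH _ ch'.
rewrite /= big_cons /=.
have m0 : 0 < (f (lkiller f u))%:R :> rat.
  by rewrite ltr0n; have /andP[h _] := rg (lkiller f u); exact: leq_trans (ltnW X1) h.
apply: le_trans (ler_wpM2l _ IH) _.
  by rewrite mulr_ge0 ?divr_ge0 // exprn_ge0.
have cm : (cell (f (lkiller f u)) <= cell (f z))%N by apply: cell_mono; apply: ltnW.
rewrite le_eqVlt; apply/orP; left; apply/eqP.
have -> : (4 * R)%N%:R ^+ cell (f z) = (4 * R)%N%:R ^+ dcell f (z, u) * (4 * R)%N%:R ^+ cell (f (lkiller f u)) :> rat.
  by rewrite -exprD /dcell /tcell /= subnK.
move: (_ ^+ _) (_ ^+ _) => P Q; field.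
by rewrite (gt_eqF m0) pnatr_eq0 -lt0n (ltnW X1).
Qed.

(** Inside a cell, [nfree] is at least [N - grid g.+1]. Across cells, [gap / nfree <= f x.1 / N],
    which splits as [(f x.1 / a) * (a / N)] with [a <= 2 * grid g] the label of [m_i]; then
    [2 * R * 2 ^ d <= (4 * R) ^ d] for [d > 0] absorbs the constants. *)
Lemma step_bound f z us x : lchain f z us -> inrange f -> x \in trans f z us ->
  [/\ 0 < slack f x * wt f x &
   (slack f x * wt f x)^-1 <= #|tpend f x|%:R * ghat f x *
     ((f x.1)%:R / (f (lkiller f x.2))%:R * (4 * R)%N%:R ^+ dcell f x)].
Proof.
move=> ch rg xin; have [[uM zM l1 l2 eux] _] := trans_chain esym eirr ch xin.
have [mM emu _ mz] := killerP uM.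
have [_ c1 c2] := cellP (rg (lkiller f x.2)); rewrite -/(tcell f x) in c1 c2.
have d0 : (0 < #|tpend f x|)%N.
  apply/card_gt0P; exists x.2; rewrite in_set eux /=; apply/forall_inP => w wM; apply/implyP => ewu.
  exact: leq_trans c1 (keyv_lt_le' (mz w wM ewu)).
set a := nat_of_ord (f (lkiller f x.2)) in l1 c1 c2 *.
have bN : (f x.1 < N)%N by [].
have nf0 : (0 < nfree f x)%N by rewrite /nfree subn_gt0; exact: leq_ltn_trans l1 (ltn_ord _).
have gp0 : (0 < gap f x)%N by rewrite /gap subn_gt0; exact: leq_ltn_trans l1 l2.
have a0 : (0 < a)%N by have /andP[h _] := rg (lkiller f x.2); exact: leq_trans (ltnW X1) h.
have w0 : 0 < wt f x by rewrite /wt mulr_gt0 // invr_gt0 ?ltr0n // exprn_gt0.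
have r0 : 0 < slack f x by rewrite /slack divr_gt0 ?ltr0n.
split; first exact: mulr_gt0.
have -> : (slack f x * wt f x)^-1 = #|tpend f x|%:R * ((gap f x)%:R / (nfree f x)%:R * 2 ^+ dcell f x).
  rewrite /slack /wt; move: (2 ^+ _) (_%:R) (_%:R) (_%:R) => p q r d.
  by rewrite invfM invf_div invfM !invrK; ring.
rewrite -[X in _ <= X]mulrA ler_wpM2l //.
have ba1 : 1 <= (f x.1)%:R / a%:R :> rat.
  by rewrite ler_pdivlMr ?ltr0n // mul1r ler_nat; exact: ltnW (ltn_trans l1 l2).
rewrite /ghat; case: eqP => [dc|/eqP dc].
  rewrite dc !expr0 !mulr1; apply: (@le_trans _ _ ((gap f x)%:R * kappa (tcell f x))).
    rewrite ler_wpM2l // /kappa lef_pV2 ?posrE ?ltr0n ?subn_gt0 //.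
      by rewrite ler_nat /nfree -/a leq_sub2l.
      exact: leq_ltn_trans l1 (ltn_ord _).
    by have [] := grid_room (leq_ltn_trans c1 (ltn_ord _)).
  by rewrite ler_peMr // mulr_ge0 // invr_ge0.
have gb : (gap f x)%:R / (nfree f x)%:R <= (f x.1)%:R / N%:R :> rat.
  rewrite ler_pdivrMr ?ltr0n // mulrAC ler_pdivlMr ?ltr0n // -!natrM ler_nat /gap /nfree -/a.
  rewrite mulnBl mulnBr leq_sub2l // mulnC leq_mul2l; apply/orP; right; exact: ltnW.
have a2x : (a <= 2 * grid (tcell f x))%N by apply: leq_trans (ltnW c2) (gridS_le _ _ _ _).
have pw : 2 * R%:R * 2 ^+ dcell f x <= (4 * R)%N%:R ^+ dcell f x :> rat.
  case: (dcell f x) dc => // k _; rewrite !exprS natrM.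
  have h : 2 ^+ k <= (4 * R%:R) ^+ k :> rat.
    rewrite lerXn2r ?nnegrE ?mulr_ge0 //.
    have : 1 <= R%:R :> rat by rewrite ler1n. 
    by lra.
  have := @ler_wpM2l _ (4 * R%:R : rat) _ _ _ h; rewrite mulr_ge0 // => /(_ isT); lra.
have N0' : 0 < N%:R :> rat by rewrite ltr0n.
have R0' : 0 < R%:R :> rat by rewrite ltr0n.
have a0' : 0 < a%:R :> rat by rewrite ltr0n.
apply: (@le_trans _ _ ((f x.1)%:R / N%:R * 2 ^+ dcell f x)); first by rewrite ler_wpM2r ?exprn_ge0.
set b : rat := (f x.1)%:R; set g : rat := (grid (tcell f x))%:R.
have a2x' : a%:R <= 2 * g by rewrite -natrM ler_nat.
have b0 : 0 <= b by [].
set p := 2 ^+ _ in pw *; set q := _ ^+ _ in pw *; have p0 : 0 <= p by rewrite exprn_ge0.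
have E1 : b / N%:R * p = (b / a%:R) * (a%:R / N%:R) * p by field; rewrite !gt_eqF.
have E2 : g / (R * N)%N%:R * (b / a%:R * q) = (b / a%:R) * (g / N%:R) * (q / R%:R).
  by rewrite natrM; field; rewrite !gt_eqF.
have g0 : 0 <= g by [].
have key : a%:R * p <= g * (q / R%:R).
  rewrite mulrA ler_pdivlMr //; apply: (@le_trans _ _ (2 * g * p * R%:R)).
    by rewrite !ler_wpM2r // ltW.
  have -> : 2 * g * p * R%:R = g * (2 * R%:R * p) by ring.
  exact: ler_wpM2l.
rewrite E1 E2; have -> : b / a%:R * (a%:R / N%:R) * p = (b / a%:R / N%:R) * (a%:R * p) by ring.
have -> : b / a%:R * (g / N%:R) * (q / R%:R) = (b / a%:R / N%:R) * (g * (q / R%:R)) by ring.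
by apply: ler_wpM2l => //; rewrite !divr_ge0.
Qed.

(** [telescope] gives [2 ^ J * (4 * R) ^ Jf], and AM-GM turns the bound of [sum_ghat] into the
    [L]-th power. *)
Lemma prod_bound f z us L (T : nat) : lchain f z us -> inrange f -> size us = L ->
  (load f z us <= T)%N ->
  1 <= 2 ^+ J * (4 * R)%N%:R ^+ Jf * (3 * T%:R / (R * N * L)%N%:R) ^+ L *
    \prod_(x <- trans f z us) (slack f x * wt f x).
Proof.
move=> ch rg sz le.
pose W x := slack f x * wt f x.
have Wpos : 0 < \prod_(x <- trans f z us) W x.
  rewrite big_seq; apply: prodr_gt0 => x xin.
  by have [] := step_bound ch rg xin.
rewrite -[X in X <= _](mulVf (lt0r_neq0 Wpos)) ler_wpM2r ?(ltW Wpos) // -prodfV.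
apply: (@le_trans _ _ (\prod_(x <- trans f z us) (#|tpend f x|%:R * ghat f x) *
   \prod_(x <- trans f z us) ((f x.1)%:R / (f (lkiller f x.2))%:R * (4 * R)%N%:R ^+ dcell f x))).
  rewrite -big_split /= big_seq [X in _ <= X]big_seq; apply: ler_prod => x xin.
  have [w1 w2] := step_bound ch rg xin.
  by rewrite invr_ge0 (ltW w1).
rewrite mulrC; apply: ler_pM.
- by apply: prodr_ge0 => x _; rewrite mulr_ge0 ?divr_ge0 ?exprn_ge0.
- by apply: prodr_ge0 => x _; rewrite mulr_ge0 ?ghat_ge0.
- apply: le_trans (telescope ch rg) _; apply: ler_pM; rewrite ?divr_ge0 ?exprn_ge0 //.
    rewrite ler_pdivrMr ?ltr0n ?(ltnW X1) // -natrX -natrM -NE ler_nat ltnW //.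
  rewrite ler_weXn2l ?ler1n ?muln_gt0 //.
  by have [cl _ _] := cellP (rg z); apply: ltnW.
apply: le_trans (AGM_seq _ _) _ => [x|]; first by rewrite mulr_ge0 ?ghat_ge0.
have st : size (trans f z us) = L by rewrite -sz -{2}(trans_us e f z us) size_map.
rewrite st lerXn2r ?nnegrE ?divr_ge0 ?mulr_ge0 //.
  by apply: sumr_ge0 => x _; rewrite mulr_ge0 ?ghat_ge0.
have -> : 3 * T%:R / (R * N * L)%N%:R = 3 * T%:R / (R * N)%N%:R / L%:R :> rat.
  by rewrite [in LHS]natrM invfM mulrA.
rewrite ler_wpM2r ?invr_ge0 //; apply: le_trans (sum_ghat ch rg) _.
by rewrite ler_wpM2r ?invr_ge0 // ler_wpM2l // ler_nat.
Qed.

Lemma stage2 (L T : nat) (A : {set Lab * V * L.-tuple V}) :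
  (forall a, a \in A -> [/\ inrange a.1.1, lchain a.1.1 a.1.2 a.2 &
     (load a.1.1 a.1.2 a.2 <= T)%N]) ->
  #|A|%:R <= 2 ^+ J * (4 * R)%N%:R ^+ Jf * (3 * T%:R / (R * N * L)%N%:R) ^+ L *
    (n%:R * (N ^ n)%:R * 2 ^+ L) :> rat.
Proof.
move=> HA; apply: card_le_sum => [|a /HA[rg ch le]].
  by rewrite !mulr_ge0 ?exprn_ge0 // divr_ge0 ?mulr_ge0.
by split=> //; apply: prod_bound (size_tuple _) le.
Qed.

End Stage2Count.

(** * Assembly *)

Lemma card_exists_le (I T : finType) (P : I -> pred T) :
  #|[set t | [exists i, P i t]]| <= \sum_i #|[set t | P i t]|.
Proof.
rewrite -sum1_card (eq_bigr (fun i => \sum_t (P i t : nat))); last first.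
  move=> i _; rewrite -sum1_card big_mkcond /=; apply: eq_bigr => t _.
  by rewrite inE; case: (P i t).
rewrite exchange_big /= big_mkcond /=; apply: leq_sum => t _; rewrite inE.
by case: existsP => // -[i Pi]; rewrite (bigD1 i) //= Pi.
Qed.

Lemma card_window_le (N a k : nat) (P : pred 'I_N) :
  (forall t, P t -> a <= t < a + k) -> #|P| <= k.
Proof.
move=> H; rewrite cardE -(size_map val) -[X in _ <= X](size_iota a k); apply: uniq_leq_size.
  by rewrite map_inj_uniq ?enum_uniq //; apply: val_inj.
by move=> _ /mapP[t tP ->]; rewrite mem_iota; apply: H; move: tP; rewrite mem_enum.
Qed.

Lemma fact_le_pow m k : k <= m -> k`! <= m ^ k.
Proof.
elim: k => // k IH le; rewrite factS expnS leq_mul //; exact/IH/ltnW.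
Qed.

Section Assembly.
Variables (n : nat) (e : rel 'I_n).
Hypotheses (esym : symmetric e) (eirr : irreflexive e) (n2 : 1 < n).
Variables (J k R b : nat).
(** [tau] makes the base in [stage1_load] equal to [2 ^ k * (L * N)], and [R = 24 * tau] makes
    [3 * T / (R * N * L)] in [stage2] equal to 1/8. *)
Let tau := 8 * (2 ^ k).+1 + 2.
Hypotheses (J0 : 0 < J) (k32 : 32 <= k) (RE : R = 24 * tau) (bE : 4 * R <= 2 ^ b).
(** [X] is a multiple of the separation in [nice], so two given labels are too close with
    probability at most [2 ^- J]. [Jf] comes from [grid_reach], and [L] makes [4 ^ L] at least
    [2 ^ (2 * J) * (4 * R) ^ Jf]. *)
Let X := 2 ^ (J + 5) * (2 * R).
Let N := 2 ^ J * X.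
Let Jf := 8 * R * J.
Let L := (2 + 8 * b * R) * J.
Let T := tau * (L * N).
Local Notation V := 'I_n.
Local Notation Lab := {ffun V -> 'I_N}.
Implicit Types (f : Lab).

Let tau0 : 0 < tau. Proof. by rewrite /tau addn_gt0 orbT. Qed.
Let R0 : 0 < R. Proof. by rewrite RE muln_gt0 tau0. Qed.
Let X1 : 1 < X. Proof. by rewrite /X; have := expn_gt0 2 (J + 5); nia. Qed.
Let XR : 2 * R <= X. Proof. by rewrite /X leq_pmull // expn_gt0. Qed.
Let X0 : 0 < X. Proof. exact: ltnW. Qed.
Let N0 : 0 < N. Proof. by rewrite /N muln_gt0 expn_gt0 X0. Qed.
Let L0 : 0 < L. Proof. by rewrite /L muln_gt0 J0 andbT addn_gt0. Qed.
Let v0 : V := Ordinal (ltnW n2).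

Definition outside f := [exists v, ~~ ((X <= f v) && (f v < N - X))].
Definition crowded f :=
  [exists p : V * V, (p.1 != p.2) && ((f p.1 < f p.2) && (f p.2 < f p.1 + 2 ^ (J + 5)))].

Lemma card_outside : #|[set f | outside f]| * 2 ^ J <= 2 * n * N ^ n.
Proof.
rewrite -(leq_pmul2r X0) -mulnA -/N.
apply: leq_trans (leq_mul (card_exists_le _) (leqnn N)) _.
rewrite big_distrl /= (eq_bigr (fun=> #|[pred t : 'I_N | ~~ ((X <= t) && (t < N - X))]| * N ^ n)); last first.
  by move=> v _; rewrite -(card_label1 v).
rewrite sum_nat_const card_ord.
suff le : #|[pred t : 'I_N | ~~ ((X <= t) && (t < N - X))]| <= 2 * X.
  by apply: leq_trans (leq_mul (leqnn n) (leq_mul le (leqnn _))) _; lia.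
pose P1 := [pred t : 'I_N | t < X]; pose P2 := [pred t : 'I_N | N - X <= t].
have c1 : #|P1| <= X by apply: (card_window_le (a := 0)) => t.
have c2 : #|P2| <= X.
  apply: (card_window_le (a := N - X)) => t /= ->; have := ltn_ord t; lia.
apply: leq_trans (_ : #|[predU P1 & P2]| <= _).
  by apply: subset_leq_card; apply/subsetP => t; rewrite !inE /=; lia.
apply: leq_trans (leq_addr #|[predI P1 & P2]| _) _.
by rewrite cardUI mul2n -addnn leq_add.
Qed.

Lemma card_crowded : #|[set f | crowded f]| * 2 ^ J <= n ^ 2 * N ^ n.
Proof.
rewrite -(leq_pmul2r X0) -mulnA -/N.
apply: leq_trans (leq_mul (card_exists_le _) (leqnn N)) _.
rewrite big_distrl /=; apply: leq_trans (_ : \sum_(p : V * V) 2 ^ (J + 5) * N ^ n <= _).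
  apply: leq_sum => -[u v] _ /=; case: (boolP (u == v)) => nuv /=; last first.
    apply: (card_label2 (r := fun s t : 'I_N => (s < t) && (t < s + 2 ^ (J + 5)))) => // s.
    by apply: (card_window_le (a := s)) => t /andP[l1 l2]; rewrite ltnW.
  by rewrite (_ : [set _ | _] = set0) ?cards0 //; apply/setP => f; rewrite !inE.
rewrite sum_nat_const card_prod !card_ord -mulnn /X.
have : 2 ^ (J + 5) <= 2 ^ (J + 5) * (2 * R) by rewrite leq_pmulr // muln_gt0.
move: (_ ^ (J + 5)) (N ^ n) => s p le.
have -> : n * n * p * (s * (2 * R)) = n * n * (s * (2 * R) * p) by lia.
by rewrite leq_mul2l leq_mul2r le !orbT.
Qed.

Lemma nice_range f : ~~ outside f -> ~~ crowded f -> injective f ->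
  nice X J f /\ inrange X R Jf f.
Proof.
rewrite negb_exists => /forallP H1; rewrite negb_exists => /forallP H2 fI.
have H v : X <= f v < N - X by have := H1 v; rewrite negbK.
split; [split=> [v|u v nuv lt]|move=> v].
- by have /andP[] := H v.
- by have := H2 (u, v); rewrite /= nuv lt /= -leqNgt.
have /andP[-> lt] := H v; apply: leq_trans lt _.
exact: grid_reach.
Qed.

Notation triple := (Lab * V * L.-tuple V)%type.

Definition goodpath (a : triple) :=
  [&& ~~ outside a.1.1, ~~ crowded a.1.1, injectiveb a.1.1 & lchain e a.1.1 a.1.2 a.2].
Definition heavy : {set triple} := [set a | goodpath a && (T <= load e X R Jf a.1.1 a.1.2 a.2)].
Definition light : {set triple} := [set a | goodpath a && ~~ (T <= load e X R Jf a.1.1 a.1.2 a.2)].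

Lemma goodpathP a : goodpath a -> [/\ nice X J a.1.1, inrange X R Jf a.1.1 & lchain e a.1.1 a.1.2 a.2].
Proof. by case/and4P => o c /injectiveP fI ch; have [] := nice_range o c fI. Qed.

Lemma card_heavy : #|heavy| * 2 ^ J <= n * N ^ n.
Proof.
have HA a : a \in heavy -> [/\ nice X J a.1.1, inrange X R Jf a.1.1, lchain e a.1.1 a.1.2 a.2 &
     T <= load e X R Jf a.1.1 a.1.2 a.2].
  by rewrite inE => /andP[/goodpathP[]].
have := stage1_load esym eirr v0 X1 R0 (erefl N) HA.
have -> : (T - 2 * (L * N)) %/ 8 - L * N = 2 ^ k * (L * N).
  rewrite /T /tau -mulnBl addnK -mulnA mulKn // mulSn addKn //.
rewrite [(2 ^ k * _) ^ L]expnMn [(L * N) ^ L]expnMn => le.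
have Nn0 : 0 < N ^ n by rewrite expn_gt0 N0.
have LL0 : 0 < L ^ L by rewrite expn_gt0 L0.
have NL : N ^ n <= N ^ L * N ^ (n - L).
  by rewrite -expnD -maxnE leq_pexp2l ?leq_maxr.
have step : #|heavy| * (2 ^ k) ^ L <= N ^ n * n * ((2 ^ (12 * L + 2 * J)) ^ 2 * 3 ^ (L.*2 + L)).
  rewrite -(leq_pmul2r Nn0) -(leq_pmul2r LL0).
  apply: leq_trans (_ : #|heavy| * ((2 ^ k) ^ L * (L ^ L * N ^ L)) * N ^ (n - L) <= _).
    have -> : #|heavy| * ((2 ^ k) ^ L * (L ^ L * N ^ L)) * N ^ (n - L) =
              #|heavy| * (2 ^ k) ^ L * L ^ L * (N ^ L * N ^ (n - L)) by lia.
    by rewrite mulnAC leq_mul.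
  apply: leq_trans le _.
  have := fact_le_pow (leqnn L).
  move: (_ ^ 2 * _) (N ^ n) (L`!) (L ^ L) => c p q r qr.
  have -> : p * p * n * c * q = p * n * c * p * q by lia.
  by rewrite leq_mul2l qr orbT.
have three : 3 ^ (L.*2 + L) <= 2 ^ (5 * L).
  have -> : L.*2 + L = 3 * L by lia.
  by rewrite [3 ^ (3 * L)]expnM [2 ^ (5 * L)]expnM; apply: leq_expn.
(* Of the [32 * L] bits gained, the codes cost [29 * L + 4 * J]; the remaining [3 * L] cover [4 * J]
   and the wanted [J]. *)
have kk : 2 ^ (32 * L) <= (2 ^ k) ^ L by rewrite -expnM leq_exp2l // leq_mul2r k32 orbT.
have JL2 : 2 * J <= L by rewrite /L leq_mul2r leq_addr orbT.
have JL : 5 * J <= 3 * L by apply: leq_trans (leq_mul (leqnn 3) JL2); rewrite mulnA leq_mul2r orbT.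
have E : 2 ^ (32 * L) = 2 ^ (29 * L) * 2 ^ (3 * L) by rewrite -expnD; congr (_ ^ _); lia.
have E2 : (2 ^ (12 * L + 2 * J)) ^ 2 * 2 ^ (5 * L) = 2 ^ (29 * L) * 2 ^ (4 * J).
  by rewrite -expnM -!expnD; congr (_ ^ _); lia.
have p29 : 0 < 2 ^ (29 * L) by rewrite expn_gt0.
have p4 : 0 < 2 ^ (4 * J) by rewrite expn_gt0.
have s2 : #|heavy| * 2 ^ (3 * L) <= n * N ^ n * 2 ^ (4 * J).
  rewrite -(leq_pmul2r p29).
  apply: leq_trans (_ : #|heavy| * (2 ^ k) ^ L <= _).
    by rewrite -mulnA leq_mul2l [_ * 2 ^ (29 * L)]mulnC -E kk orbT.
  apply: leq_trans step _.
  have -> : n * N ^ n * 2 ^ (4 * J) * 2 ^ (29 * L) = N ^ n * n * (2 ^ (29 * L) * 2 ^ (4 * J)) by lia.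
  by rewrite -E2 leq_mul2l leq_mul2l three !orbT.
rewrite -(leq_pmul2r p4); apply: leq_trans s2.
by rewrite -mulnA -expnD leq_mul2l leq_exp2l // orbC (_ : J + 4 * J <= 3 * L) //; lia.
Qed.

Lemma card_light : #|light| * 2 ^ J <= n * N ^ n.
Proof.
have HA a : a \in light -> [/\ inrange X R Jf a.1.1, lchain e a.1.1 a.1.2 a.2 &
     load e X R Jf a.1.1 a.1.2 a.2 <= T].
  by rewrite inE => /andP[/goodpathP[_ ? ?]]; rewrite -ltnNge => /ltnW.
have := stage2 esym eirr X1 R0 (erefl N) HA.
have RL : (0 < (R * N * L)%N%:R :> rat)%R by rewrite ltr0n muln_gt0 L0 muln_gt0 R0 N0.
have -> : (3 * T%:R / (R * N * L)%N%:R = 8^-1 :> rat)%R.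
  apply: (canLR (mulfK (lt0r_neq0 RL))).
  have -> : R * N * L = 24 * T by rewrite /T RE -(mulnA (24 * tau)) -(mulnA 24) (mulnC N).
  by rewrite natrM mulrA; congr (_ * _)%R.
(* The factors per step multiply to [2 * 1/8 = 1/4], hence a gain of [4 ^ L]. *)
have p : (0 < (4 ^ L)%N%:R :> rat)%R by rewrite ltr0n expn_gt0.
rewrite -(ler_pM2r p).
have -> : (2 ^+ J * (4 * R)%N%:R ^+ Jf * 8^-1 ^+ L * (n%:R * (N ^ n)%N%:R * 2 ^+ L) * (4 ^ L)%N%:R =
           2 ^+ J * (4 * R)%N%:R ^+ Jf * (n%:R * (N ^ n)%N%:R) :> rat)%R.
  rewrite [(4 ^ L)%N%:R%R]natrX; have : (8^-1 ^+ L * 2 ^+ L * 4%:R ^+ L = 1 :> rat)%R.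
    by rewrite -!exprMn (_ : (8^-1 * 2 * 4%:R = 1 :> rat)%R) ?expr1n.
  move: (8^-1 ^+ L)%R (2 ^+ L)%R (4%:R ^+ L)%R => x y z xyz.
  by rewrite -[RHS]mulr1 -xyz; ring.
rewrite -!natrX -!natrM ler_nat => le.
have bb : (4 * R) ^ Jf <= 2 ^ (b * Jf) by rewrite expnM; apply: leq_expn.
have E : 2 ^ J * (2 ^ J * 2 ^ (b * Jf)) <= 4 ^ L.
  by rewrite -!expnD (_ : 4 = 2 ^ 2) // -expnM leq_exp2l // /Jf /L; nia.
have p0 : 0 < 2 ^ J * 2 ^ (b * Jf) by rewrite muln_gt0 !expn_gt0.
rewrite -(leq_pmul2r p0); apply: leq_trans (_ : #|light| * 4 ^ L <= _).
  by rewrite -mulnA leq_mul2l E orbT.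
by apply: leq_trans le _; rewrite mulnC leq_mul2l leq_mul2l bb !orbT.
Qed.

Definition longpath f := [exists z, [exists us : L.-tuple V, lchain e f z us]].

Lemma card_longpath :
  #|[set f in injlabels n N | longpath f]| * 2 ^ J <= 3 * n ^ 2 * N ^ n.
Proof.
have sub : [set f in injlabels n N | longpath f] \subset
   [set f | outside f] :|: [set f | crowded f] :|: [set a.1.1 | a in heavy] :|: [set a.1.1 | a in light].
  apply/subsetP => f; rewrite in_set => /andP[fI /existsP[z /existsP[us ch]]].
  rewrite in_set in fI; rewrite !in_setU ![f \in [set _ | _]]in_set.
  case: (boolP (outside f)) => //= o; case: (boolP (crowded f)) => //= c.
  have gp : goodpath (f, z, us) by rewrite /goodpath /= o c fI ch.
  case: (boolP (T <= load e X R Jf f z us)) => h; apply/orP; [left|right].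
    by apply/imsetP; exists (f, z, us) => //; rewrite in_set gp.
  by apply/imsetP; exists (f, z, us) => //; rewrite in_set gp.
have := subset_leq_card sub => le.
have le2 : #|[set f in injlabels n N | longpath f]| <=
   #|[set f | outside f]| + #|[set f | crowded f]| + #|heavy| + #|light|.
  apply: leq_trans le _; apply: leq_trans (leq_card_setU _ _) _.
  apply: leq_add; last exact: leq_imset_card.
  apply: leq_trans (leq_card_setU _ _) _; apply: leq_add; last exact: leq_imset_card.
  exact: leq_card_setU.
apply: leq_trans (leq_mul le2 (leqnn _)) _; rewrite !mulnDl.
have h1 := card_outside; have h2 := card_crowded; have h3 := card_heavy; have h4 := card_light.
apply: leq_trans (leq_add (leq_add (leq_add h1 h2) h3) h4) _.
by rewrite -!mulnDl leq_mul2r; apply/orP; right; nia.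
Qed.

Lemma chain_lchain f z us : injective f ->
  chain e (fun v => rank f v : nat) z us -> lchain e f z us.
Proof.
move=> fI.
have keyE u v : (key f u < key f v) = (f u < f v).
  apply/idP/idP; last exact: keyv_lt.
  case: (ltngtP (f u) (f v)) => // [gt|/val_inj/fI->]; last by rewrite ltnn.
  by rewrite ltnNge ltnW // keyv_lt.
rewrite (@chain_iso _ e _ (key f)) => [|u v]; last by rewrite rank_lt keyE.
elim: us z => //= u us IH z /andP[-> /and4P[-> l1 l2 /IH ->]].
by move: l1 l2; rewrite !keyE /lkiller => -> ->.
Qed.

Lemma card_long_perm : 
  #|[set s : {perm V} | [exists z, [exists us : L.-tuple V, chain e (Defs.pos s) z us]]]| * 2 ^ J <=
  6 * n ^ 2 * n`!.
Proof.
(* If [2 ^ J] is below [2 * n ^ 2], counting all permutations is enough. *)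
have n2N : 2 * n ^ 2 <= N \/ 2 ^ J < 2 * n ^ 2.
  case: (leqP (2 * n ^ 2) (2 ^ J)) => le; [left|by right].
  by apply: leq_trans le _; rewrite /N leq_pmulr.
case: n2N => [n2N|lt].
  have := perm_bound (ltnW n2) (P := fun s => [exists z, [exists us : L.-tuple V, chain e (Defs.pos s) z us]])
    (Q := longpath) (M := 2 ^ J) (K := 3 * n ^ 2) n2N _ card_longpath.
  rewrite mulnA; apply => f fI /existsP[z /existsP[us ch]].
  apply/existsP; exists z; apply/existsP; exists us; apply: chain_lchain => //.
  move: ch; rewrite (@chain_iso _ e _ (fun v => rank f v : nat)) // => u v.
  by rewrite /Defs.pos invgK !rankpE.
apply: leq_trans (leq_mul (max_card _) (ltnW lt)) _.
by rewrite card_Sn mulnC leq_mul2r; apply/orP; right; lia.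
Qed.

End Assembly.

Lemma rounds_nat (c : nat) : exists K : nat, 0 < K /\
  forall n (e : rel 'I_n), symmetric e -> irreflexive e -> 1 < n ->
  exists B : {set {perm 'I_n}}, #|B| * n ^ c <= n`! /\
    forall s, s \notin B -> num_rounds e s <= K * (trunc_log 2 n).+1.
Proof.
have [k k32] : exists k, 32 <= k by exists 32.
pose R := 24 * (8 * (2 ^ k).+1 + 2).
have [b bE] : exists b, 4 * R <= 2 ^ b by exists (4 * R); apply/ltnW/ltn_expl.
exists ((2 + 8 * b * R) * (c + 5)); split; first by rewrite muln_gt0 !addn_gt0 orbT.
move=> n e esym eirr n2; set l := (trunc_log 2 n).+1.
(* This gives [2 ^ J >= n ^ (c + 5)], where [n ^ 3 >= 8] absorbs the factor 6 of
   [card_long_perm]. *)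
pose J := (c + 5) * l; have J0 : 0 < J by rewrite muln_gt0 addn_gt0 orbT.
have card := card_long_perm esym eirr n2 J0 k32 (erefl R) bE.
set P := [set s | _] in card; exists P; split; last first.
  move=> s; apply: contraNT; rewrite -ltnNge -mulnA => /(num_rounds_chain esym eirr)[z [us [sz ch]]].
  rewrite in_set; apply/existsP; exists z; apply/existsP.
  by exists (Tuple (introT eqP sz)).
have nl : n <= 2 ^ l by apply/ltnW/trunc_log_ltn.
have big : 6 * n ^ 2 * n ^ c <= 2 ^ J.
  have -> : 2 ^ J = (2 ^ l) ^ (c + 5) by rewrite -expnM mulnC.
  apply: leq_trans (leq_expn (c + 5) nl).
  have -> : n ^ (c + 5) = n ^ 3 * n ^ 2 * n ^ c by rewrite -!expnD; congr (_ ^ _); lia.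
  rewrite !leq_mul2r; apply/orP; right; apply/orP; right.
  by apply: leq_trans (leq_expn 3 n2).
have n0 : 0 < 6 * n ^ 2 by rewrite muln_gt0 expn_gt0 (ltnW n2).
rewrite -(leq_pmul2l n0); apply: leq_trans card.
by rewrite (mulnCA (6 * n ^ 2)) leq_mul2l big orbT.
Qed.

(** * Transfer to real constants and the natural logarithm *)

Lemma INR_le (a b : nat) : (a <= b)%N -> Rle (INR a) (INR b).
Proof. by move=> /ssrnat.leP; apply: le_INR. Qed.

Lemma INR_expn (a k : nat) : INR (a ^ k)%N = pow (INR a) k.
Proof. by elim: k => //= k IH; rewrite expnS -multE mult_INR IH. Qed.

Theorem theorem1p1 :
  forall c : R, Rle 2 c ->
  exists C : R, Rlt 0 C /\
    forall (n : nat), (2 <= n)%N ->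
    forall e : rel 'I_n, symmetric e -> irreflexive e ->
      Rle (Rminus 1 (Rpower (INR n) (Ropp c)))
          (prob_within e (Rmult C (ln (INR n)))).
Proof.
(* A natural exponent [c' > c] only strengthens the bound. *)
move=> c c2; have [c' cc'] := INR_unbounded c.
have [K [K0 HK]] := rounds_nat c'.
have ln2 : Rlt 0 (ln 2) by rewrite -ln_1; apply: ln_increasing; Lra.lra.
have INRK : Rlt 0 (INR K) by apply: lt_0_INR; apply/ssrnat.ltP.
(* For [n >= 2], [(trunc_log 2 n).+1] is at most twice the binary logarithm of [n], whence
   [2 / ln 2]. *)
exists (Rmult (INR K) (Rdiv 2 (ln 2))); split.
  by apply: Rmult_lt_0_compat => //; apply: Rdiv_lt_0_compat; Lra.lra.
move=> n n2 e esym eirr; have [B [cB HB]] := HK n e esym eirr n2.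
have INRn : Rle 2 (INR n) by apply: (INR_le n2).
have t1 : (1 <= trunc_log 2 n)%N by rewrite trunc_log_gt0.
have logn : Rle (Rmult (INR (trunc_log 2 n)) (ln 2)) (ln (INR n)).
  rewrite -ln_pow; last Lra.lra.
  have : (2 ^ trunc_log 2 n <= n)%N by apply: trunc_logP => //; apply: ltnW.
  move=> /INR_le; rewrite INR_expn => le.
  have p0 : Rlt 0 (pow 2 (trunc_log 2 n)) by apply: pow_lt; Lra.lra.
  by case: le => [lt|->]; [left; apply: ln_increasing|right].
set t := Rmult _ (ln (INR n)).
have within s : s \notin B -> Rleb (INR (num_rounds e s)) t.
  move=> /HB le; rewrite /Rleb; case: Rle_dec => // -[]; apply: Rle_trans (INR_le le) _.
  rewrite -multE mult_INR S_INR /t !Rmult_assoc; apply: Rmult_le_compat_l; first Lra.lra.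
  have h1 := INR_le t1; rewrite /= in h1.
  apply: (Rmult_le_reg_r (ln 2)) => //.
  have -> : Rmult (Rmult 2 (Rmult (Rinv (ln 2)) (ln (INR n)))) (ln 2) = Rmult 2 (ln (INR n)).
    by rewrite (Rmult_comm (Rinv (ln 2))) -!Rmult_assoc Rmult_assoc Rinv_l ?Rmult_1_r //; Lra.lra.
  by Lra.nra.
have F0 : Rlt 0 (INR n`!) by apply: lt_0_INR; apply/ssrnat.ltP; apply: fact_gt0.
have p0 : Rlt 0 (pow (INR n) c') by apply: pow_lt; Lra.lra.
rewrite /prob_within; set good := [set pi | _].
have cP : #|{perm 'I_n}| = n`! by exact: card_Sn.
rewrite cP.
have sub : (n`! <= #|good| + #|B|)%N.
  rewrite -cP -(cardsC B) addnC leq_add2r; apply: subset_leq_card.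
  by apply/subsetP => s; rewrite !inE; apply: within.
have bad : Rle (Rmult (INR #|B|) (pow (INR n) c')) (INR n`!).
  by rewrite -INR_expn -mult_INR multE; apply: INR_le.
have sum := INR_le sub; rewrite -plusE plus_INR in sum.
have pw : Rle (Rinv (pow (INR n) c')) (Rpower (INR n) (Ropp c)).
  rewrite -Rpower_pow; last Lra.lra.
  rewrite -Rpower_Ropp; apply: Rle_Rpower; Lra.lra.
apply: (Rle_trans _ (Rminus 1 (Rinv (pow (INR n) c')))); first Lra.lra.
apply: (Rmult_le_reg_r (INR n`!)) => //.
have -> : Rmult (Rdiv (INR #|good|) (INR n`!)) (INR n`!) = INR #|good|.
  by rewrite /Rdiv Rmult_assoc Rinv_l ?Rmult_1_r //; Lra.lra.
have : Rle (INR #|B|) (Rmult (Rinv (pow (INR n) c')) (INR n`!)).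
  apply: (Rmult_le_reg_r (pow (INR n) c')) => //.
  have -> : Rmult (Rmult (Rinv (pow (INR n) c')) (INR n`!)) (pow (INR n) c') = INR n`!.
    by rewrite (Rmult_comm (Rinv _)) Rmult_assoc Rinv_l ?Rmult_1_r //; Lra.lra.
  by [].
Lra.lra.
Qed.
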